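(* Let $L$ be an arbitrary logical operator of weight $W$ in a qLDPC code. Then a suitable graph $G$ for the gauging measurement of $L$ can be constructed with qubit overhead $O(W\log^3 W)$.
   Context: Codes and asymptotics. A stabilizer code is specified by commuting Pauli checks $\{s_i\}$ generating a group not containing $-\mathbb 1$. Its distance is the minimum weight of a Pauli operator that commutes with all checks but is not, up to phase, a product of checks. ''qLDPC''/''LDPC'' refers to a family of codes whose checks have weight bounded by a constant and in which each qubit is acted on by at most a constant number of checks; constants (including that in $O(\cdot)$) are uniform over the family. A logical operator $L$ is a Pauli operator commuting with all checks; bases are chosen per qubit so that $L=\prod_{v\in\mathrm{supp}(L)}X_v$. The $Z$-type support of a Pauli operator is the set of qubits on which it acts by $Y$ or $Z$. Auxiliary graph and deformed code. $G=(V,E)$ is a connected graph whose vertex set contains the qubits of $\mathrm{supp}(L)$; any additional vertices are called dummy vertices and carry no qubit. One auxiliary qubit is placed on each edge; the qubit overhead is $|E|$. The deformed code is the stabilizer code on the original qubits together with the edge qubits with the following checks (signs of the $A_v$ are given by measurement outcomes and are irrelevant here): - $A_v=X_v\prod_{e\ni v}X_e$ for non-dummy $v\in V$, and $A_v=\prod_{e\ni v}X_e$ for dummy $v\in V$; - $B_p=\prod_{e\in p}Z_e$ for $p$ in a chosen generating set of cycles of $G$ (generating the $\mathbb Z_2$ cycle space); - $\tilde s_i=s_i\prod_{e\in\mu_i}Z_e$ for every original check $s_i$, where $\mu_i\subseteq E$ is a chosen set of edges whose $\mathbb Z_2$-boundary is the (even-sized) set of vertices given by the intersection of the $Z$-type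 support of $s_i$ with $\mathrm{supp}(L)$. A suitable graph for $L$ is a connected graph $G$ for which (with some choice of generating cycles and sets $\mu_i$) the deformed code is LDPC and has code distance at least that of the original code. *)

(* Defs.v *)
From HB Require Import structures.
From mathcomp Require Import all_boot all_order all_algebra all_fingroup.
From mathcomp Require Import zify ring.

Set Implicit Arguments.
Unset Strict Implicit.
Unset Printing Implicit Defensive.

Import GRing.Theory.

Local Open Scope group_scope.

(* Pauli k A B is the operator i^k X(A) Z(B), where X(A) is the product of the
   X_q for q in A; in particular Y_q = i X_q Z_q is Pauli 1 [set q] [set q]. *)
Record pauli (Q : finType) := Pauli {
  phase : 'Z_4;
  xpart : {set Q};
  zpart : {set Q}
}.

Definition pauli_tuple (Q : finType) (P : pauli Q) := (phase P, xpart P, zpart P).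
Definition tuple_pauli (Q : finType) (u : 'Z_4 * {set Q} * {set Q}) : pauli Q :=
  Pauli u.1.1 u.1.2 u.2.

Lemma pauli_tupleK (Q : finType) : cancel (@pauli_tuple Q) (@tuple_pauli Q).
Proof. by case. Qed.

HB.instance Definition _ (Q : finType) :=
  Finite.copy (pauli Q) (can_type (@pauli_tupleK Q)).

Section PauliGroup.
Variable Q : finType.
Implicit Types (A B C : {set Q}) (P : pauli Q).

Definition symdiff A B : {set Q} := [set q | (q \in A) (+) (q \in B)].

(* Moving Z(B) past X(A') produces the sign (-1)^|B :&: A'|. *)
Definition pauli_mul P P' : pauli Q :=
  Pauli (phase P + phase P' + (2 * #|zpart P :&: xpart P'|)%:R)%R
        (symdiff (xpart P) (xpart P')) (symdiff (zpart P) (zpart P')).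

Definition pauli_one : pauli Q := Pauli 0%R set0 set0.

Definition pauli_inv P : pauli Q :=
  Pauli (- phase P - (2 * #|zpart P :&: xpart P|)%:R)%R (xpart P) (zpart P).

Lemma symdiffA : associative symdiff.
Proof. by move=> A B C; apply/setP => q; rewrite !inE addbA. Qed.

Lemma symdiffC : commutative symdiff.
Proof. by move=> A B; apply/setP => q; rewrite !inE addbC. Qed.

Lemma double_card_symdiffI A B C :
  ((2 * #|C :&: symdiff A B|)%:R =
   (2 * #|C :&: A|)%:R + (2 * #|C :&: B|)%:R :> 'Z_4)%R.
Proof.
have e4 : (4%:R = 0 :> 'Z_4)%R by apply/val_inj.
have -> : C :&: symdiff A B = ((C :&: A) :\: B) :|: ((C :&: B) :\: A).
  apply/setP => q; rewrite !inE.
  by case: (q \in A) (q \in B) (q \in C) => [] [] [].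
rewrite cardsU (_ : ((C :&: A) :\: B) :&: ((C :&: B) :\: A) = set0); last first.
  apply/setP => q; rewrite !inE.
  by case: (q \in A) (q \in B) (q \in C) => [] [] [].
rewrite cards0 subn0 -(cardsID B (C :&: A)) -(cardsID A (C :&: B)) setIAC.
set a := #|C :&: B :&: A|; set b := #|_ :\: B|; set c := #|_ :\: A|.
rewrite -[RHS]natrD.
have -> : (2 * (a + b) + 2 * (a + c) = 2 * (b + c) + 4 * a)%N by lia.
by rewrite natrD (natrM _ 4) e4 mul0r addr0.
Qed.

Lemma pauli_mulA : associative pauli_mul.
Proof.
move=> [k A B] [k' A' B'] [l A'' B'']; rewrite /pauli_mul /=.
rewrite !symdiffA; congr Pauli.
rewrite double_card_symdiffI (setIC (symdiff B B')) double_card_symdiffI.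
rewrite !(setIC A''); ring.
Qed.

Lemma pauli_mul1 : left_id pauli_one pauli_mul.
Proof.
move=> [k A B]; rewrite /pauli_mul /= set0I cards0 muln0 addr0 add0r.
by congr Pauli; apply/setP => q; rewrite !inE.
Qed.

Lemma pauli_mulV : left_inverse pauli_one pauli_inv pauli_mul.
Proof.
move=> [k A B]; rewrite /pauli_mul /pauli_one /=; congr Pauli.
- by rewrite addrAC addrNK addNr.
- by apply/setP => q; rewrite !inE addbb.
- by apply/setP => q; rewrite !inE addbb.
Qed.

HB.instance Definition _ :=
  Finite_isGroup.Build (pauli Q) pauli_mulA pauli_mul1 pauli_mulV.

End PauliGroup.

Definition scalar_pauli (Q : finType) (k : 'Z_4) : pauli Q :=
  Pauli k set0 set0.

Definition supp (Q : finType) (P : pauli Q) : {set Q} := xpart P :|: zpart P.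

Definition weight (Q : finType) (P : pauli Q) : nat := #|supp P|.

Section Codes.
Variables (Q I : finType) (s : I -> pauli Q).

Definition checks : {set pauli Q} := [set s i | i : I].

(* The last clause says that -1 is not in the group generated by the checks. *)
Definition stabilizer_code : Prop :=
  (forall i j, commute (s i) (s j)) /\
  scalar_pauli Q 2%R \notin <<checks>>.

Definition logicals : {set pauli Q} := 'C(checks).

Definition nontrivial_logicals : {set pauli Q} :=
  [set P in logicals | ~~ [exists k, scalar_pauli Q k * P \in <<checks>>]].

(* None stands for an infinite distance: every logical is trivial. *)
Definition distance : option nat :=
  if [pick P in nontrivial_logicals] is Some P0
  then Some (weight [arg min_(P < P0 in nontrivial_logicals) weight P])
  else None.

Definition ldpc (w D : nat) : Prop :=
  (forall i, (weight (s i) <= w)%N) /\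
  (forall q, (#|[set i | q \in supp (s i)]| <= D)%N).

End Codes.

Definition distance_le (d d' : option nat) : bool :=
  match d, d' with
  | _, None => true
  | None, Some _ => false
  | Some a, Some b => (a <= b)%N
  end.

Definition qldpc (T : Type) (Q I : T -> finType)
    (s : forall t, I t -> pauli (Q t)) : Prop :=
  exists w D : nat, forall t, ldpc (s t) w D.

(* A choice of basis on each qubit, i.e. a product of single-qubit Clifford
   unitaries acting by conjugation: these are exactly the endomorphisms of the
   Pauli group that fix the scalars and preserve supports. *)
Definition basis_change (Q : finType) (phi : pauli Q -> pauli Q) : Prop :=
  [/\ {morph phi : P P' / P * P'},
      forall k, phi (scalar_pauli Q k) = scalar_pauli Q k
    & forall P, supp (phi P) = supp P].

Section Graphs.
Variables (Q : finType) (S : {set Q}).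

(* Simple graphs whose vertices are the qubits of S and some dummy vertices. *)
Record aux_graph := AuxGraph {
  dummy : finType;
  edges : {set {set {q | q \in S} + dummy}};
  edges_card : forall e, e \in edges -> #|e| = 2
}.

Variable G : aux_graph.

Definition vertex : finType := ({q | q \in S} + dummy G)%type.
Definition edge : finType := {e : {set vertex} | e \in edges G}.

Definition adj : rel vertex := [rel u v | [set u; v] \in edges G].

Definition connected_graph : Prop :=
  (0 < #|vertex|)%N /\ forall u v, connect adj u v.

Definition cycle_edges (c : seq vertex) : {set edge} :=
  [set e | [exists v, (v \in c) && (val e == [set v; next c v])]].

Definition is_cycle (p : {set edge}) : Prop :=
  exists c, [/\ (2 < size c)%N, ucycle adj c & p = cycle_edges c].

(* The boundary over Z/2. *)
Definition boundary (p : {set edge}) : {set vertex} :=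
  [set v | odd #|[set e in p | v \in val e]|].

Definition generates_cycle_space (J : finType) (p : J -> {set edge}) : Prop :=
  forall c : {set edge}, boundary c = set0 ->
  exists K : {set J}, c = [set e | odd #|[set j in K | e \in p j]|].

Definition vertices_in (A : {set Q}) : {set vertex} :=
  [set v | if v is inl u then val u \in A else false].

Section DeformedCode.
Variables (I J : finType) (s : I -> pauli Q).
Variables (p : J -> {set edge}) (mu : I -> {set edge}) (sgn : vertex -> bool).

Definition vertex_check (v : vertex) : pauli (Q + edge)%type :=
  Pauli (if sgn v then 2%R else 0%R)
    [set x : Q + edge |
       match x with
       | inl q => if v is inl u then q == val u else false
       | inr e => v \in val e
       end]
    set0.

Definition cycle_check (j : J) : pauli (Q + edge)%type :=
  Pauli 0%R set0 [set x : Q + edge | if x is inr e then e \in p j else false].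

Definition deformed_check (i : I) : pauli (Q + edge)%type :=
  Pauli (phase (s i))
    [set x : Q + edge | if x is inl q then q \in xpart (s i) else false]
    [set x : Q + edge |
       match x with
       | inl q => q \in zpart (s i)
       | inr e => e \in mu i
       end].

Definition deformed_code (k : (vertex + J + I)%type) : pauli (Q + edge)%type :=
  match k with
  | inl (inl v) => vertex_check v
  | inl (inr j) => cycle_check j
  | inr i => deformed_check i
  end.

End DeformedCode.

(* The bases are those in which the measured operator is X(S) up to a phase.
   The signs sgn of the vertex checks are measurement outcomes: some choice
   must be consistent (only signs making -1 a product of checks are not), and
   the other requirements, which do not depend on the signs, are imposed for
   every choice. *)
Definition suitable (w D : nat) (I : finType) (s : I -> pauli Q) : Prop :=
  connected_graph /\
  exists (J : finType) (p : J -> {set edge}) (mu : I -> {set edge}),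
    [/\ (forall j, is_cycle (p j)) /\ generates_cycle_space p,
        forall i, boundary (mu i) = vertices_in (zpart (s i)),
        exists sgn, stabilizer_code (deformed_code s p mu sgn),
        forall sgn, ldpc (deformed_code s p mu sgn) w D
      & forall sgn,
          distance_le (distance s) (distance (deformed_code s p mu sgn))].

End Graphs.

(* Main.v *)
(** The deformed distance is controlled by a relative expansion: a logical of
    the deformed code has X part on the edges equal to the coboundary of some
    vertex set K, and multiplying by the checks in K (or in its complement)
    turns it into a logical of the original code at the price of
    min(|K & supp L|, |supp L - K|) qubits, so it suffices that the coboundary
    of every K has at least that size.

    With W <= 2^n, such a graph is the n-dimensional hypercube blown up to
    bounded degree: every hypercube vertex x becomes an n x n grid, and the
    edge of direction d is present on row d and column d.  Two directions d, d'
    meet at position (d, d'), so all hypercube squares survive as 4-cycles, and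
    with the grid squares they fill every cycle.  Column 0 is a butterfly
    network, and averaging over one direction per level gives the expansion
    without loss.  The qubits of supp L hang as leaves at (x, 0, 0).

    Qubits lying in a common check are joined by boundedly many involutions of
    the hypercube (colour the conflict graph).  Each involution pi is routed by
    Benes' decomposition: at each level it is composed on both sides with moves
    along one direction, until it is the identity at the last level.  Adding at each level
    the rungs from x to the image of x under the residual permutation keeps the
    degree bounded, shortcuts the pairs at level 0, and all new cycles are
    filled by 4-cycles from the last level upwards.  Since every cycle of
    length at most 4 may be used as a check, boundedness of the checks reduces
    to boundedness of the degree.  The overhead is O(W log^2 W). *)

Require Import Defs.
From mathcomp Require Import all_boot all_order all_algebra all_fingroup.
From mathcomp Require Import zify ring lra.

Set Implicit Arguments.
Unset Strict Implicit.
Unset Printing Implicit Defensive.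

Import Order.TTheory GRing.Theory Num.Theory.

(** * Covering a bounded-degree graph by boundedly many involutions *)

Section GreedyColouring.
Variable T : finType.

Lemma greedy_colouring (r : rel T) (d : nat) :
  symmetric r -> (forall x, #|[set y | r x y]| <= d) ->
  exists f : T -> 'I_d.+1, forall x y, x != y -> r x y -> f x != f y.
Proof.
move=> r_sym deg.
suff [f fP] : exists f : T -> 'I_d.+1,
    {in enum T &, forall x y, x != y -> r x y -> f x != f y}.
  by exists f => x y; apply: fP; rewrite mem_enum.
have: uniq (enum T) by exact: enum_uniq.
elim: (enum T) => [_|z l IHl /= /andP[zl /IHl[f fP]]]; first by exists (fun=> ord0).
have [c cP] : exists c, c \notin f @: [set y | r z y].
  apply/existsP; rewrite -negb_forall; apply/negP => /forallP allc.
  have : #|'I_d.+1| <= #|f @: [set y | r z y]|.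
    by apply/subset_leq_card/subsetP => c _; exact: allc.
  by rewrite card_ord leqNgt ltnS (leq_trans (leq_imset_card _ _)).
exists (fun x => if x == z then c else f x) => x y; rewrite !inE.
case: (eqVneq x z) => [->|xz] /=; case: (eqVneq y z) => [->|yz] //=.
- move=> _ yl _ zy; apply: contraNneq cP => ->.
  by apply: imset_f; rewrite inE.
- move=> xl _ _ xz'; apply: contraNneq cP => <-.
  by apply: imset_f; rewrite inE r_sym.
- by move=> xl yl; exact: fP.
Qed.

(* Colour the points so that points at distance at most two get distinct
   colours; a pair of colours then spans a partial matching. *)
Lemma involution_cover (r : rel T) (d : nat) :
  symmetric r -> irreflexive r -> (forall x, #|[set y | r x y]| <= d) ->
  exists f : 'I_(d + d * d).+1 * 'I_(d + d * d).+1 -> T -> T,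
    (forall c, involutive (f c)) /\ forall x y, r x y -> exists c, f c x = y.
Proof.
move=> r_sym r_irr deg.
pose r2 := [rel x z | r x z || [exists y, r x y && r y z]].
have r2_sym : symmetric r2.
  move=> x y /=; rewrite r_sym; congr (_ || _).
  by apply: eq_existsb => z; rewrite andbC (r_sym y) (r_sym x).
have deg2 x : #|[set z | r2 x z]| <= d + d * d.
  have -> : [set z | r2 x z] =
      [set z | r x z] :|: \bigcup_(y in [set y | r x y]) [set z | r y z].
    apply/setP => z; rewrite !inE /=; congr (_ || _).
    apply/existsP/bigcupP => [[y /andP[xy yz]]|[y]].
      by exists y; rewrite inE.
    by rewrite !inE => xy yz; exists y; rewrite xy.
  rewrite (leq_trans (leq_card_setU _ _)) // leq_add //.
  apply: leq_trans (_ : \sum_(y in [set y | r x y]) d <= _).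
    elim/big_ind2: _ => [|A m B n Am Bn|y _]; rewrite ?cards0 //.
    by rewrite (leq_trans (leq_card_setU _ _)) // leq_add.
  by rewrite sum_nat_const leq_mul.
have [col colP] := greedy_colouring r2_sym deg2.
(* [nb c] joins related points whose colours form the pair [c]. Two partners of one point would have
   to share a colour with each other or with it, at distance at most two, so this is a partial
   matching. *)
pose nb (c : 'I_(d + d * d).+1 * 'I_(d + d * d).+1) x y := r x y &&
  ((col x == c.1) && (col y == c.2) || (col x == c.2) && (col y == c.1)).
have nb_sym c : symmetric (nb c).
  by move=> x y; rewrite /nb r_sym orbC !(andbC (col y == _)).
have nb_uniq c x y z : nb c x y -> nb c x z -> y = z.
  move=> /andP[xy cxy] /andP[xz cxz]; apply/eqP/negPn/negP => yz.
  have cxy' : col x != col y.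
    apply: colP => /=; last by rewrite xy.
    by apply/eqP => e; rewrite e r_irr in xy.
  have : col y != col z.
    by apply: colP yz _ => /=; apply/orP; right; apply/existsP; exists x; rewrite r_sym xy.
  move: cxy cxz cxy' => /orP[]/andP[/eqP-> /eqP->] /orP[]/andP[/eqP e /eqP->] //; rewrite ?e ?eqxx //.
(* Unmatched points are fixed, which keeps each map an involution. *)
exists (fun c x => odflt x [pick y | nb c x y]); split=> [c x|x y xy].
  case: (pickP (nb c x)) => [y xy|nox] /=; last first.
    by case: pickP => // y; rewrite nox.
  case: (pickP (nb c y)) => [z yz|/(_ x)] /=; last by rewrite nb_sym xy.
  by apply: nb_uniq yz _; rewrite nb_sym.
exists (col x, col y); case: pickP => [z|/(_ y)] /=; last first.
  by rewrite /nb xy !eqxx.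
by move=> /nb_uniq; apply; rewrite /nb xy !eqxx.
Qed.

End GreedyColouring.

(** * Benes decomposition of a permutation of the hypercube *)

Section Benes.

(* The orbits of x and a x under a \o b are distinct and exchanged by both
   involutions, so colouring orbits by comparing representatives works. *)
Lemma two_colouring (X : finType) (a b : X -> X) :
  involutive a -> involutive b -> (forall x, a x != x) -> (forall x, b x != x) ->
  exists f : X -> bool, forall x, f (a x) = ~~ f x /\ f (b x) = ~~ f x.
Proof.
move=> aK bK afix bfix; pose g x := a (b x).
have g_inj : injective g by apply: inj_comp; apply: inv_inj.
(* If the (k+2)-nd iterate of [g] at [x] is [a x], then the k-th iterate at [g x] is [a (g x)]. The
   descent in steps of two ends at a fixed point of [a] or of [b]. *)
have noiter k x : iter k g x != a x.
  elim/ltn_ind: k x => -[|[|k]] IH x; first by rewrite eq_sym.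
    by rewrite /= /g (inj_eq (inv_inj aK)).
  apply/eqP; rewrite iterS /g => /(inv_inj aK).
  move=> /(congr1 b); rewrite bK iterSr => e.
  by have := IH k (leqW (leqnn _)) (g x); rewrite e /g aK eqxx.
have root_neq x : froot g x != froot g (a x).
  rewrite eq_sym root_connect; last exact: fconnect_sym.
  rewrite fconnect_sym //; apply/negP => /iter_findex e.
  by have := noiter (findex g x (a x)) x; rewrite e eqxx.
have root_g x : froot g (g x) = froot g x.
  apply/eqP; rewrite root_connect; last exact: fconnect_sym.
  by rewrite fconnect_sym //; exact: fconnect1.
pose f x := enum_rank (froot g x) < enum_rank (froot g (a x)).
have fa x : f (a x) = ~~ f x.
  rewrite /f aK -leqNgt ltn_neqAle.
  case: eqP => //= /val_inj /enum_rank_inj e.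
  by have := root_neq x; rewrite e eqxx.
exists f => x; split=> //; rewrite -fa /f aK.
have e : g (b x) = a x by rewrite /g bK.
by rewrite -(root_g (b x)) e (root_g x : froot g (a (b x)) = _).
Qed.

Variable m : nat.
Implicit Types (x y z : {set 'I_m}) (a b : 'I_m).

(** Hypercube vertices are sets of directions; this is the neighbour of [x] in direction [a]. *)
Definition flip a x : {set 'I_m} := symdiff x [set a].

Lemma in_flip a x b : (b \in flip a x) = (b \in x) (+) (b == a).
Proof. by rewrite !inE. Qed.

Lemma flipK a : involutive (flip a).
Proof. by move=> x; apply/setP => b; rewrite !in_flip addbK. Qed.

Lemma flip_neq a x : flip a x != x.
Proof.
by apply/eqP => /setP/(_ a); rewrite in_flip eqxx addbT; case: (a \in x).
Qed.

Lemma flipC a b x : flip a (flip b x) = flip b (flip a x).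
Proof. by apply/setP => c; rewrite !in_flip addbAC. Qed.

(** One direction at a time, the residual permutation is made to preserve one more coordinate. A
    two-colouring prescribes the value of this coordinate both before and after the permutation, so
    that both adjustments are bijections. *)
Lemma benes (p : {set 'I_m} -> {set 'I_m}) : injective p ->
  exists P : nat -> {set 'I_m} -> {set 'I_m},
    [/\ forall k, injective (P k), P 0 =1 p, P m =1 id &
    forall a x, exists y z, [/\ y = x \/ y = flip a x,
      z = P a.+1 y & P a x = z \/ P a x = flip a z]].
Proof.
pose fixes k (q : {set 'I_m} -> {set 'I_m}) :=
  forall x a, a < k -> (a \in q x) = (a \in x).
suff H j k : j + k = m -> forall q, injective q -> fixes k q ->
    exists P : nat -> {set 'I_m} -> {set 'I_m},
    [/\ forall i, injective (P i), P k =1 q, P m =1 id &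
    forall a x, k <= a -> exists y z, [/\ y = x \/ y = flip a x,
      z = P a.+1 y & P a x = z \/ P a x = flip a z]].
  move=> p_inj; have [//|P [Pi P0 Pm PP]] := H m 0 (addn0 m) p p_inj _.
  by exists P; split=> // a x; exact: PP.
elim: j k => [|j IHj] k jk q q_inj q_fix.
  exists (fun=> q); split=> // [x|a x].
    by apply/setP => a; apply: q_fix; have := ltn_ord a; lia.
  by have := ltn_ord a; lia.
have km : k < m by lia.
pose a := Ordinal km.
have q_bij : bijective q by exact: injF_bij.
have [q' qK q'K] := q_bij.
(* [be] exchanges points whose images under [q] are neighbours in direction [a]; the colouring
   separates these pairs as well as the neighbours themselves. *)
pose al := flip a; pose be x := q' (flip a (q x)).
have beK : involutive be by move=> x; rewrite /be q'K flipK qK.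
have be_neq x : be x != x.
  by apply/eqP => /(congr1 q); rewrite /be q'K => /eqP; rewrite (negPf (flip_neq _ _)).
have [f fP] := two_colouring (flipK a) beK (flip_neq a) be_neq.
(* [put c] sets coordinate [a] to [c]. It can only identify neighbours in direction [a], and those
   carry opposite colours. *)
pose put (c : bool) x := if (a \in x) == c then x else flip a x.
have putE c x b : (b \in put c x) = if b == a then c else b \in x.
  rewrite /put; case: (eqVneq b a) => [->|ba].
    by case: eqP => [//|]; rewrite in_flip eqxx; case: (a \in x); case: c.
  by case: ifP => // _; rewrite in_flip (negPf ba) addbF.
have put_eq c x y : put c x = put c y -> x = y \/ x = flip a y.
  move=> e; case: (eqVneq (a \in x) (a \in y)) => axy; [left|right]; apply/setP => b.
    by move/setP/(_ b): e; rewrite !putE; case: eqP => // ->.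
  rewrite in_flip; move/setP/(_ b): e; rewrite !putE.
  by case: eqP => [->|_ ->]; [move: axy; case: (a \in x); case: (a \in y)|rewrite addbF].
have t_inj : injective (fun x => put (f x) x).
  move=> x y e.
  have fxy : f x = f y by move/setP/(_ a): e; rewrite !putE eqxx.
  move: e; rewrite fxy => /put_eq[//|e].
  by have [] := fP y; rewrite -e fxy; case: (f y).
have s_inj : injective (fun x => put (f x) (q x)).
  move=> x y e.
  have fxy : f x = f y by move/setP/(_ a): e; rewrite !putE eqxx.
  move: e; rewrite fxy => /put_eq[/q_inj //|e].
  have xbe : x = be y by rewrite /be -e qK.
  by have [_] := fP y; rewrite -xbe fxy; case: (f y).
have [t' tK t'K] := injF_bij t_inj.
(* The residual permutation sends [put (f x) x] to [put (f x) (q x)]; both have the bit [f x] at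
   [a], so coordinate [a] is now preserved too. *)
pose q1 x := put (f (t' x)) (q (t' x)).
have q1_inj : injective q1.
  by move=> x y /s_inj e; rewrite -[x]t'K e t'K.
have q1_fix : fixes k.+1 q1.
  move=> x b bk; rewrite putE -[in RHS](t'K x) putE.
  case: eqP => // /eqP ba; apply: q_fix.
  by move: ba; rewrite -val_eqE /=; lia.
have [|P [Pi P0 Pm PP]] := IHj k.+1 _ q1 q1_inj q1_fix; first by lia.
exists (fun i => if i == k then q else P i); split=> [i||x|b x kb].
- by case: ifP => _.
- by move=> x; rewrite eqxx.
- by rewrite gtn_eqF.
case: (eqVneq (b : nat) k) => [bk|bk]; last first.
  have [|y [z [yx ze pz]]] := PP b x; first by lia.
  by exists y, z; split=> //; case: eqP => //; lia.
have {bk kb} -> : b = a by exact: val_inj.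
exists (put (f x) x), (put (f x) (q x)); split.
- by rewrite /put; case: ifP; [left|right].
- by rewrite /= gtn_eqF // P0 /q1 tK.
- by rewrite /put; case: ifP; [left|right; rewrite flipK].
Qed.

End Benes.

(** * L1 expansion of the butterfly by successive averaging *)

Section CubeExpansion.
Variable m : nat.
Implicit Types (x : {set 'I_m.+1}) (a b : 'I_m.+1).
Implicit Types (f : nat -> {set 'I_m.+1} -> rat) (g h : {set 'I_m.+1} -> rat).
Local Open Scope ring_scope.

Definition average a g x : rat := (g x + g (flip a x)) / 2.

Lemma sum_flip a (g : {set 'I_m.+1} -> rat) : \sum_x g (flip a x) = \sum_x g x.
Proof. by rewrite [RHS](reindex_inj (inv_inj (flipK a))). Qed.

Lemma average_contraction a g h :
  \sum_x `|average a g x - average a h x| <= \sum_x `|g x - h x|.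
Proof.
have -> : \sum_x `|g x - h x| =
    \sum_x (`|g x - h x| + `|g (flip a x) - h (flip a x)|) / 2.
  rewrite -mulr_suml big_split /= (sum_flip a (fun x => `|g x - h x|)); by field.
apply: ler_sum => x _; rewrite /average.
have -> : (g x + g (flip a x)) / 2 - (h x + h (flip a x)) / 2 =
  ((g x - h x) + (g (flip a x) - h (flip a x))) / 2 by field.
by rewrite normrM (@ger0_norm _ 2^-1) // ler_wpM2r // ler_normD.
Qed.

(** With E_i the average in direction i, this is E_k E_(k+1) ... E_(k+j-1) applied to f_(k+j). *)
Fixpoint iter_average f k j {struct j} : {set 'I_m.+1} -> rat :=
  if j is j'.+1 then average (inord k) (iter_average f k.+1 j') else f k.

(** For an indicator function this counts the cut butterfly edges at level [k]: cross edges, seen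
    from both ends and hence halved, plus descents to the next level. *)
Definition variation f k : rat :=
  \sum_x `|f k x - f k (flip (inord k) x)| / 2 + \sum_x `|f k x - f k.+1 x|.

(* Telescoping: f_k - E_k H = (f_k - E_k f_k) + E_k (f_k - f_(k+1))
   + E_k (f_(k+1) - H), where the averages E_k are L1-contractions. *)
Lemma iter_average_le f k j :
  \sum_x `|f k x - iter_average f k j x| <= \sum_(k <= i < k + j) variation f i.
Proof.
elim: j k => [|j IHj] k /=.
  by rewrite addn0 big_geq // big1 // => x _; rewrite subrr normr0.
rewrite addnS big_nat_recl ?leq_addr //= -(big_add1 _ _ k (k + j).+1 xpredT (variation f)) /=.
have := IHj k.+1; rewrite addSn => IH.
apply: le_trans (_ : variation f k + \sum_x `|f k.+1 x - iter_average f k.+1 j x| <= _); last first.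
  by rewrite lerD2l.
apply: le_trans (_ : \sum_x (`|f k x - average (inord k) (f k) x| +
   `|average (inord k) (f k) x - average (inord k) (f k.+1) x| +
   `|average (inord k) (f k.+1) x - average (inord k) (iter_average f k.+1 j) x|) <= _).
  apply: ler_sum => x _.
  rewrite -[X in `|X|](subrKA (average (inord k) (f k) x)) (le_trans (ler_normD _ _)) //.
  rewrite -addrA lerD2l -[X in `|X|](subrKA (average (inord k) (f k.+1) x)).
  exact: ler_normD.
rewrite !big_split /= lerD ?average_contraction // /variation.
rewrite lerD ?average_contraction // ler_sum // => x _.
have -> : f k x - average (inord k) (f k) x = (f k x - f k (flip (inord k) x)) / 2.
  by rewrite /average; field.
by rewrite normrM [`|2^-1|]ger0_norm.
Qed.

Lemma average_range a g : (forall x, 0 <= g x <= 1) -> forall x, 0 <= average a g x <= 1.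
Proof. by move=> g01 x; have := g01 x; have := g01 (flip a x); rewrite /average; lra. Qed.

Lemma flip_invariant_const g : (forall a x, g (flip a x) = g x) -> forall x, g x = g set0.
Proof.
move=> gI x; move: {2}#|x| (erefl #|x|) => n; elim: n x => [|n IHn] x.
  by move=> /cards0_eq ->.
move=> xn; have /card_gt0P[a ax] : (0 < #|x|)%N by rewrite xn.
have e : flip a x = x :\ a.
  by apply/setP => b; rewrite in_flip !inE; case: eqP => [->|]; rewrite ?ax ?addbF.
by rewrite -(gI a) IHn // e; have := cardsD1 a x; rewrite ax xn => -[].
Qed.

Lemma iter_average_flip f k j a x : (k <= a < k + j)%N ->
  iter_average f k j (flip a x) = iter_average f k j x.
Proof.
elim: j k x => [|j IHj] k x /=; first by lia.
move=> kaj; case: (eqVneq (a : nat) k) => [ak|ak].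
  have -> : inord k = a by apply: val_inj; rewrite /= inordK // -ak.
  by rewrite /average flipK addrC.
by rewrite /average -flipC !IHj //; lia.
Qed.

(** Averaging once in every direction leaves a function invariant under all flips, hence a constant;
    this constant is [t]. *)
Lemma cube_expansion f : (forall k x, 0 <= f k x <= 1) ->
  exists2 t, 0 <= t <= 1 & \sum_x `|f 0 x - t| <= \sum_(i < m.+1) variation f i.
Proof.
move=> f01.
have H01 k j x : 0 <= iter_average f k j x <= 1.
  by elim: j k x => [|j IHj] k //=; apply: average_range.
exists (iter_average f 0 m.+1 set0) => //.
rewrite -(big_mkord xpredT (variation f)); apply: le_trans (iter_average_le f 0 m.+1).
apply: ler_sum => x _; rewrite -(@flip_invariant_const (iter_average f 0 m.+1) _ x) //.
by move=> a y; rewrite iter_average_flip // ltn_ord.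
Qed.

End CubeExpansion.

(** * Sets as vectors over Z/2 *)

Section Symdiff.
Variable T : finType.
Implicit Types A B C : {set T}.

Lemma symdiff0 A : symdiff A set0 = A.
Proof. by apply/setP => x; rewrite !inE addbF. Qed.

Lemma symdiffxx A : symdiff A A = set0.
Proof. by apply/setP => x; rewrite !inE addbb. Qed.

Lemma symdiff_trans A B C : symdiff (symdiff A B) (symdiff B C) = symdiff A C.
Proof. by rewrite symdiffA -(symdiffA A) symdiffxx symdiff0. Qed.

Lemma odd_card A : odd #|A| = \big[addb/false]_x (x \in A).
Proof.
rewrite -sum1_card (big_morph odd oddD (erefl _)) big_mkcond.
by apply: eq_bigr => x _; case: (x \in A).
Qed.

Lemma odd_card_symdiff A B : odd #|symdiff A B| = odd #|A| (+) odd #|B|.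
Proof. by rewrite !odd_card -big_split; apply: eq_bigr => x _; rewrite inE. Qed.

Lemma odd_cardI_symdiff A B C :
  odd #|A :&: symdiff B C| = odd #|A :&: B| (+) odd #|A :&: C|.
Proof.
rewrite -odd_card_symdiff; congr (odd #|pred_of_set _|).
by apply/setP => x; rewrite !inE andb_addr.
Qed.

Lemma card_set1I x A : #|[set x] :&: A| = (x \in A).
Proof.
case: (boolP (x \in A)) => xA; first by rewrite (setIidPl _) ?sub1set ?cards1.
by apply/eqP; rewrite cards_eq0 setI_eq0 disjoints1.
Qed.

End Symdiff.

Section Mod2Sum.
Variables (J T : finType) (p : J -> {set T}).
Implicit Types K : {set J}.

Definition mod2_sum K : {set T} := [set x | odd #|[set j in K | x \in p j]|].

Lemma mod2_sum0 : mod2_sum set0 = set0.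
Proof. by apply/setP => x; rewrite !inE setIdE set0I cards0. Qed.

Lemma mod2_sum1 j : mod2_sum [set j] = p j.
Proof. by apply/setP => x; rewrite inE setIdE card_set1I inE oddb. Qed.

Lemma mod2_sumD K K' : mod2_sum (symdiff K K') = symdiff (mod2_sum K) (mod2_sum K').
Proof.
apply/setP => x; rewrite !inE -odd_card_symdiff; congr (odd #|pred_of_set _|).
by apply/setP => j; rewrite !inE andb_addl.
Qed.

End Mod2Sum.

(** * Phases, Pauli operators and single-qubit basis changes *)

Section Phases.
Local Open Scope ring_scope.

(** A sign (-1)^n is the exponent 2n in ['Z_4], so comparing signs amounts to comparing parities. *)
Lemma Z4_double_eq (m n : nat) :
  ((2 * m)%:R == (2 * n)%:R :> 'Z_4) = (odd m == odd n).
Proof.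
rewrite -(inj_eq val_inj) /= !val_Zp_nat //.
have -> : (2 * m = (m./2 * 4 + 2 * odd m))%N by rewrite -[in LHS](odd_double_half m); lia.
have -> : (2 * n = (n./2 * 4 + 2 * odd n))%N by rewrite -[in LHS](odd_double_half n); lia.
by rewrite !modnMDl; case: (odd m) (odd n) => [] [].
Qed.

Lemma card_Z4 (T : finType) (A : {set T}) : #|A|%:R = \sum_x (x \in A)%:R :> 'Z_4.
Proof.
rewrite -sum1_card natr_sum big_mkcond; apply: eq_bigr => x _.
by case: (x \in A).
Qed.

End Phases.

Section PauliLemmas.
Variable Q : finType.
Implicit Types (P : pauli Q) (F H : {set Q}).
Local Open Scope group_scope.

Lemma pauliME P P' : P * P' =
  Pauli (phase P + phase P' + (2 * #|zpart P :&: xpart P'|)%:R)%R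
        (symdiff (xpart P) (xpart P')) (symdiff (zpart P) (zpart P')).
Proof. by []. Qed.

Lemma pauli1E : 1 = Pauli 0%R set0 set0 :> pauli Q.
Proof. by []. Qed.

Lemma scalarM k P : scalar_pauli Q k * P = Pauli (k + phase P)%R (xpart P) (zpart P).
Proof.
rewrite pauliME /= set0I cards0 muln0 addr0.
by congr Pauli; apply/setP => q; rewrite !inE.
Qed.

Lemma commuteE P P' : commute P P' <->
  odd #|zpart P :&: xpart P'| = odd #|zpart P' :&: xpart P|.
Proof.
rewrite /commute !pauliME (symdiffC (xpart P')) (symdiffC (zpart P')).
rewrite (addrC (phase P')); split=> [/(congr1 (@phase Q)) /= /addrI/eqP|/eqP].
  by rewrite Z4_double_eq => /eqP.
by rewrite -Z4_double_eq => /eqP ->.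
Qed.

(** Conjugation by the phase gate on the qubits of [F]: X becomes Y = iXZ and Z is fixed. *)
Definition phase_gate F P : pauli Q :=
  Pauli (phase P + #|xpart P :&: F|%:R)%R (xpart P)
    (symdiff (zpart P) (xpart P :&: F)).

(** Exchange of X and Z on [H]; the sign comes from reordering ZX into XZ on the qubits carrying
    both. *)
Definition hadamard H P : pauli Q :=
  Pauli (phase P + (2 * #|xpart P :&: zpart P :&: H|)%:R)%R
    (xpart P :\: H :|: zpart P :&: H) (zpart P :\: H :|: xpart P :&: H).

Lemma phase_gate_basis_change F : basis_change (phase_gate F).
Proof.
split=> [[k A B] [k' A' B']|k|[k A B]]; rewrite /phase_gate ?pauliME /=.
- congr Pauli; last first.
    by apply/setP => q; rewrite !inE; case: (q \in A) (q \in A') (q \in F) (q \in B) (q \in B')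
      => [] [] [] [] [].
  set a := #|symdiff A A' :&: F|%:R%R; set b := (2 * _)%:R%R; set c := #|A :&: F|%:R%R.
  set d := #|A' :&: F|%:R%R; set e := (2 * _)%:R%R.
  suff E : (b + a = c + d + e)%R.
    rewrite -addrA E; ring.
  (* All exponents are sums over qubits in ['Z_4], so the identity is checked on one qubit at a
     time. *)
  rewrite /a /b /c /d /e !natrM !card_Z4 !mulr_sumr -!big_split /=.
  apply: eq_bigr => q _; rewrite !inE.
  by case: (q \in A) (q \in A') (q \in F) (q \in B) => [] [] [] []; apply/val_inj.
- rewrite /scalar_pauli set0I cards0 addr0; congr Pauli.
  by apply/setP => q; rewrite !inE.
- by apply/setP => q; rewrite /supp !inE /=; case: (q \in A) (q \in B) (q \in F) => [] [] [].
Qed.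

Lemma hadamard_basis_change H : basis_change (hadamard H).
Proof.
split=> [[k A B] [k' A' B']|k|[k A B]]; rewrite /hadamard ?pauliME /=.
- congr Pauli; last 2 first.
  + apply/setP => q; rewrite !inE.
    by case: (q \in A) (q \in A') (q \in H) (q \in B) (q \in B')
      => [] [] [] [] [].
  + apply/setP => q; rewrite !inE.
    by case: (q \in A) (q \in A') (q \in H) (q \in B) (q \in B')
      => [] [] [] [] [].
  set b := (2 * #|B :&: A'|)%:R%R; set a := (2 * _)%:R%R; set c := (2 * _)%:R%R.
  set d := (2 * _)%:R%R; set e := (2 * _)%:R%R.
  suff E : (b + a = c + d + e)%R.
    rewrite -addrA E; ring.
  rewrite /a /b /c /d /e !natrM !card_Z4 !mulr_sumr -!big_split /=.
  apply: eq_bigr => q _; rewrite !inE.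
  by case: (q \in A) (q \in A') (q \in H) (q \in B) (q \in B') => [] [] [] [] []; apply/val_inj.
- rewrite /scalar_pauli !set0I cards0 muln0 addr0; congr Pauli;
  by apply/setP => q; rewrite !inE ?andbF.
- by apply/setP => q; rewrite /supp !inE /=; case: (q \in A) (q \in B) (q \in H) => [] [] [].
Qed.

Lemma basis_change_comp (f g : pauli Q -> pauli Q) :
  basis_change f -> basis_change g -> basis_change (g \o f).
Proof.
case=> fM fs fsupp [gM gs gsupp]; split=> [P P'|k|P] /=.
- by rewrite fM gM.
- by rewrite fs gs.
- by rewrite gsupp fsupp.
Qed.

(** A kernel element has empty support, so it is a scalar, and scalars are fixed. *)
Lemma basis_change_inj (f : pauli Q -> pauli Q) : basis_change f -> injective f.
Proof.
case=> fM fs fsupp.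
have f1 : f 1 = 1 by exact: fs.
have fker P : f P = 1 -> P = 1.
  move=> fP; have := fsupp P; rewrite fP.
  case: P fP => k A B fP /esym; rewrite /supp /= setU0 => /eqP; rewrite setU_eq0.
  move=> /andP[/eqP A0 /eqP B0]; move: fP; rewrite A0 B0.
  by rewrite (fs k).
move=> P P' e; apply: (mulgI P^-1); rewrite mulVg.
have: P^-1 * P' = 1 by apply: fker; rewrite fM -e -fM mulVg.
by [].
Qed.

(** The phase gate on [A :&: B] turns the Y factors of [L] into X up to phase, and the Hadamard gate
    on [B :\: A] turns its Z factors into X. *)
Lemma basis_change_to_X L : exists f : pauli Q -> pauli Q,
  basis_change f /\ exists k, f L = Pauli k (supp L) set0.
Proof.
case: L => k A B; exists (hadamard (B :\: A) \o phase_gate (A :&: B)); split.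
  by apply: basis_change_comp; [exact: phase_gate_basis_change|exact: hadamard_basis_change].
eexists; rewrite /= /hadamard /phase_gate /supp /=; congr Pauli;
by apply/setP => q; rewrite !inE; case: (q \in A) (q \in B) => [] [].
Qed.

Section Stabilizer.
Variables (I : finType) (s : I -> pauli Q) (f : pauli Q -> pauli Q).
Hypothesis f_bc : basis_change f.

Lemma basis_change_stabilizer : stabilizer_code s -> stabilizer_code (f \o s).
Proof.
have [fM fs _] := f_bc; case=> scomm s1; split=> [i j|].
  by rewrite /commute /= -!fM scomm.
pose phi := Morphism (in2W fM : {in [set: pauli Q]%G &, {morph f : P P' / P * P'}}).
have -> : checks (f \o s) = phi @* checks s.
  rewrite morphimEsub ?subsetT //; apply/setP => P.
  apply/imsetP/imsetP => [[i _ ->]|[_ /imsetP[i _ ->] ->]].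
    by exists (s i) => //; apply/imsetP; exists i.
  by exists i.
rewrite -morphim_gen ?subsetT // morphimEsub ?subsetT //; apply/negP => /imsetP[P Ps e].
by move: s1; rewrite (basis_change_inj f_bc (etrans (fs _) e)) Ps.
Qed.

Lemma basis_change_logical L : L \in logicals s -> f L \in logicals (f \o s).
Proof.
have [fM _ _] := f_bc; move=> /centP Ls; apply/centP => _ /imsetP[i _ ->].
by rewrite /commute /= -!fM Ls // imset_f.
Qed.

End Stabilizer.

End PauliLemmas.

Lemma set_symdiff_ind (T : finType) (Pr : {set T} -> Prop) :
  Pr set0 -> (forall x, Pr [set x]) ->
  (forall A B, Pr A -> Pr B -> Pr (symdiff A B)) -> forall A, Pr A.
Proof.
move=> P0 P1 PD A; move: {2}#|A| (erefl #|A|) => n; elim: n A => [|n IHn] A.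
  by move=> /cards0_eq ->.
move=> An; have /card_gt0P[x xA] : 0 < #|A| by rewrite An.
have -> : A = symdiff [set x] (A :\ x).
  by apply/setP => y; rewrite !inE; case: eqP => [->|].
by apply: PD => //; apply: IHn; have := cardsD1 x A; rewrite xA An => -[].
Qed.

(** * Boundaries and coboundaries in the auxiliary graph *)

Section Chains.
Variables (Q : finType) (S : {set Q}) (G : aux_graph S).
Implicit Types (c d : {set edge G}) (K : {set vertex G}) (u v w : vertex G) (A B : {set Q}).

(** A set rather than an edge: it is empty when [u] and [v] are equal or not adjacent, so degenerate
    steps contribute nothing to a chain. *)
Definition link u v : {set edge G} := [set e | val e == [set u; v]].

Definition coboundary K : {set edge G} := [set e | odd #|val e :&: K|].

Definition qubits_in K : {set Q} :=
  [set q | if insub q is Some u then (inl u : vertex G) \in K else false].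

Lemma odd_cards2I (T : finType) (u v : T) (K : {set T}) : u != v ->
  odd #|[set u; v] :&: K| = (u \in K) (+) (v \in K).
Proof.
move=> uv; rewrite odd_card (bigD1 u) //= (bigD1 v) /=; last by rewrite eq_sym.
rewrite big1 ?addbF; first by rewrite !inE !eqxx orbT.
by move=> w /andP[wu wv]; rewrite !inE (negPf wu) (negPf wv).
Qed.

Lemma edge_ends (e : edge G) : exists u v, [/\ u != v, adj u v & val e = [set u; v]].
Proof.
have /eqP/cards2P[u [v [uv ev]]] := edges_card (valP e).
by exists u, v; split=> //; rewrite /adj /= -ev (valP e).
Qed.

Lemma adj_neq u v : adj u v -> u != v.
Proof.
by move=> /edges_card; rewrite cards2; case: eqP.
Qed.

Lemma adj_sym : symmetric (@adj Q S G).
Proof. by move=> u v; rewrite /adj /= setUC. Qed.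

Lemma boundary_symdiff c d :
  boundary (symdiff c d) = symdiff (boundary c) (boundary d).
Proof.
apply/setP => v; rewrite !inE -odd_card_symdiff; congr (odd #|pred_of_set _|).
by apply/setP => e; rewrite !inE andb_addl.
Qed.

Lemma boundary0 : boundary (set0 : {set edge G}) = set0.
Proof.
by apply/setP => v; rewrite !inE setIdE set0I cards0.
Qed.

Lemma coboundary_symdiff K K' :
  coboundary (symdiff K K') = symdiff (coboundary K) (coboundary K').
Proof. by apply/setP => e; rewrite !inE odd_cardI_symdiff. Qed.

Lemma qubits_in_symdiff K K' :
  qubits_in (symdiff K K') = symdiff (qubits_in K) (qubits_in K').
Proof. by apply/setP => q; rewrite !inE; case: insubP => // u; rewrite !inE. Qed.

Lemma vertices_in_symdiff A B :
  vertices_in G (symdiff A B) = symdiff (vertices_in G A) (vertices_in G B).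
Proof. by apply/setP => -[u|d]; rewrite !inE. Qed.

Lemma vertices_in0 : vertices_in G set0 = set0.
Proof. by apply/setP => -[u|d]; rewrite !inE. Qed.

(** Boundary and coboundary are adjoint for the mod 2 pairing: both sides count incidences between a
    vertex of [K] and an edge of [c]. *)
Lemma odd_coboundaryI K c :
  odd #|coboundary K :&: c| = odd #|K :&: boundary c|.
Proof.
rewrite !odd_card.
rewrite (eq_bigr (fun e => \big[addb/false]_v ((v \in K) && ((e \in c) && (v \in val e))))).
  rewrite exchange_big; apply: eq_bigr => v _; rewrite !inE odd_card big_distrr /=.
  by apply: eq_bigr => e _; rewrite !inE.
move=> e _; rewrite !inE odd_card big_distrl; apply: eq_bigr => v _.
by rewrite !inE; do !case: (_ \in _).
Qed.

Lemma card_qubits_inI K A : #|qubits_in K :&: A| = #|K :&: vertices_in G A|.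
Proof.
pose U := [set u : {q | q \in S} | ((inl u : vertex G) \in K) && (val u \in A)].
have -> : qubits_in K :&: A = val @: U.
  apply/setP => q; rewrite !inE; apply/andP/imsetP => [[]|[u]].
    by case: insubP => // u _ <- uK uA; exists u; rewrite // inE uK.
  by rewrite inE => /andP[uK uA] ->; rewrite valK.
have -> : K :&: vertices_in G A = inl @: U.
  apply/setP => -[u|d]; rewrite !inE.
    by rewrite mem_imset ?inE //; exact: inl_inj.
  by rewrite andbF; apply/esym/negbTE/imsetP => -[].
by rewrite !card_imset //; [exact: inl_inj|exact: val_inj].
Qed.

Lemma linkC u v : link u v = link v u.
Proof. by apply/setP => e; rewrite !inE setUC. Qed.

Lemma linkxx u : link u u = set0.
Proof.
apply/setP => e; rewrite !inE setUid; apply/negbTE/eqP => e1.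
by have := edges_card (valP e); rewrite e1 cards1.
Qed.

Lemma boundary_link u v : u = v \/ adj u v ->
  boundary (link u v) = symdiff [set u] [set v].
Proof.
move=> [<-|uv]; first by rewrite linkxx boundary0 symdiffxx.
have ne := adj_neq uv.
pose e0 : edge G := Sub [set u; v] uv.
have -> : link u v = [set e0].
  by apply/setP => e; rewrite !inE -val_eqE.
apply/setP => w; rewrite !inE.
have -> : [set e in [set e0] | w \in val e] = if w \in [set u; v] then [set e0] else set0.
  apply/setP => e; rewrite !inE; case: eqP => [->|/eqP/negPf ne0] /=.
    by rewrite !inE; case: ifP; rewrite !inE ?eqxx.
  by case: ifP; rewrite !inE // ne0.
rewrite !inE; case: (eqVneq w u) => [->|wu] /=.
  by rewrite cards1 (negPf ne).
by case: eqP => _; rewrite ?cards1 ?cards0.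
Qed.

Lemma odd_linkI u v c : adj u v ->
  forall e, val e = [set u; v] -> odd #|link u v :&: c| = (e \in c).
Proof.
move=> uv e eE.
have -> : link u v = [set e].
  by apply/setP => e'; rewrite !inE -eE (inj_eq val_inj).
rewrite odd_card (bigD1 e) //= !inE eqxx big1 ?addbF //.
by move=> e' /negPf e'e; rewrite !inE e'e.
Qed.

Lemma coboundary_ends K u v (e : edge G) : u != v -> val e = [set u; v] ->
  (e \in coboundary K) = (u \in K) (+) (v \in K).
Proof. by move=> uv eE; rewrite inE eE odd_cards2I. Qed.

Section Connected.
Hypothesis G_conn : connected_graph G.

(** A set that no edge leaves is closed under adjacency, hence a union of connected components. *)
Lemma coboundary_eq0 K : coboundary K = set0 -> K = set0 \/ K = setT.
Proof.
move=> K0; have clK : closed (@adj Q S G) (mem K).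
  move=> u v uv; have uv' := adj_neq uv.
  have := coboundary_ends K uv' (erefl (val (Sub [set u; v] uv : edge G))).
  rewrite K0 inE => e; suff: (u \in K) = (v \in K) by [].
  by move: e; case: (u \in K) (v \in K) => [] [].
case: (set_0Vmem K) => [->|[u uK]]; [by left|right].
apply/setP => v; rewrite [RHS]inE.
have uv : connect (@adj Q S G) u v by case: G_conn.
have e : (u \in K) = (v \in K) := closed_connect clK uv.
by rewrite -e.
Qed.

Lemma spanning_chains r : exists T : vertex G -> {set edge G},
  forall v, boundary (T v) = symdiff [set r] [set v].
Proof.
suff H v : exists c : {set edge G}, boundary c == symdiff [set r] [set v].
  by exists (fun v => xchoose (H v)) => v; apply/eqP/(xchooseP (H v)).
have /connectP[l] : connect (@adj Q S G) r v by case: G_conn.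
elim/last_ind: l v => [|l w IHl] v /=.
  by move=> _ ->; exists set0; rewrite boundary0 symdiffxx.
rewrite rcons_path last_rcons => /andP[rl lw] ->.
have [c /eqP cE] := IHl _ rl erefl.
exists (symdiff c (link (last r l) w)).
rewrite boundary_symdiff cE boundary_link; last by right.
by rewrite symdiff_trans.
Qed.

(** Even pairing with the generators extends to all cycles, so the parity of [c] along a path from a
    root depends only on the endpoint. *)
Lemma coboundary_exact c (J : finType) (p : J -> {set edge G}) :
  generates_cycle_space p -> (forall j, ~~ odd #|p j :&: c|) ->
  exists K, c = coboundary K.
Proof.
move=> gen even_p; have even d : boundary d = set0 -> ~~ odd #|d :&: c|.
  move=> /gen[K ->]; rewrite odd_card.
  rewrite (eq_bigr (fun e => \big[addb/false]_j ((j \in K) && (e \in p j :&: c)))).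
    rewrite exchange_big big1 // => j _; rewrite -big_distrr /= -odd_card.
    by rewrite (negPf (even_p j)) andbF.
  move=> e _; rewrite !inE odd_card big_distrl; apply: eq_bigr => j _.
  by rewrite !inE andbA.
have /card_gt0P[r _] : 0 < #|vertex G| by case: G_conn.
have [T TE] := spanning_chains r.
(* For an edge from [u] to [v], the chains [T u], [T v] and the edge close up to a cycle, which [c]
   meets evenly; so the parities at [u] and [v] differ exactly when the edge is in [c]. *)
exists [set v | odd #|T v :&: c|]; apply/setP => e.
have [u [v [uv auv eE]]] := edge_ends e.
rewrite (coboundary_ends _ uv eE) !inE -(odd_linkI c auv eE).
have := even (symdiff (symdiff (T u) (T v)) (link u v)).
rewrite !boundary_symdiff !TE boundary_link; last by right.
rewrite (symdiffC [set r] [set u]) symdiff_trans symdiffxx => /(_ erefl).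
rewrite setIC odd_cardI_symdiff odd_cardI_symdiff !(setIC c).
by do 3 case: (odd _).
Qed.

End Connected.
End Chains.

(** * Splitting supports into qubits and edges *)

Section SumSets.
Variables A B : finType.
Implicit Types (X : {set A}) (Y : {set B}) (Z : {set A + B}).

Definition lpart Z : {set A} := [set a | inl a \in Z].
Definition rpart Z : {set B} := [set b | inr b \in Z].
Definition sum_set X Y : {set A + B} :=
  [set x | match x with inl a => a \in X | inr b => b \in Y end].

Lemma lpart_sum X Y : lpart (sum_set X Y) = X.
Proof. by apply/setP => a; rewrite !inE. Qed.

Lemma rpart_sum X Y : rpart (sum_set X Y) = Y.
Proof. by apply/setP => b; rewrite !inE. Qed.

Lemma sum_set_parts Z : Z = sum_set (lpart Z) (rpart Z).
Proof. by apply/setP => -[a|b]; rewrite !inE. Qed.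

Lemma card_sum_set X Y : #|sum_set X Y| = #|X| + #|Y|.
Proof.
have -> : sum_set X Y = inl @: X :|: inr @: Y.
  apply/setP => -[a|b]; rewrite !inE.
    by rewrite mem_imset ?[X in _ || X](_ : _ = false) ?orbF //;
      [apply/negbTE/imsetP => -[]|exact: inl_inj].
  by rewrite mem_imset ?[X in X || _](_ : _ = false) ?orbF //;
      [apply/negbTE/imsetP => -[]|exact: inr_inj].
rewrite cardsU !card_imset; [|exact: inr_inj|exact: inl_inj].
rewrite (_ : _ :&: _ = set0) ?cards0 ?subn0 //.
by apply/setP => x; rewrite !inE; apply/negbTE/andP => -[/imsetP[a _ ->] /imsetP[]].
Qed.

Lemma sum_setI X X' Y Y' :
  sum_set X Y :&: sum_set X' Y' = sum_set (X :&: X') (Y :&: Y').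
Proof. by apply/setP => -[a|b]; rewrite !inE. Qed.

Lemma sum_set_symdiff X X' Y Y' :
  symdiff (sum_set X Y) (sum_set X' Y') = sum_set (symdiff X X') (symdiff Y Y').
Proof. by apply/setP => -[a|b]; rewrite !inE. Qed.

Lemma sum_set0 : sum_set set0 set0 = set0.
Proof. by apply/setP => -[a|b]; rewrite !inE. Qed.

End SumSets.

(** * The stabilizer group of the deformed code *)

Section DeformedCodeTheory.
Variables (Q : finType) (S : {set Q}) (G : aux_graph S) (I J : finType).
Variables (s : I -> pauli Q) (p : J -> {set edge G}) (mu : I -> {set edge G}).
Hypothesis G_conn : connected_graph G.
Hypothesis p_cycle : forall j, boundary (p j) = set0.
Hypothesis p_gen : generates_cycle_space p.
Hypothesis mu_boundary : forall i, boundary (mu i) = vertices_in G (zpart (s i)).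
Hypothesis s_code : stabilizer_code s.

Implicit Types (K : {set vertex G}) (c d : {set edge G}) (g : pauli Q).
Implicit Types (P : pauli (Q + edge G)%type) (A B : {set Q}).
Local Open Scope group_scope.

(** The product of the vertex checks over [K]: an edge inside [K] is hit twice, so X survives on the
    coboundary only. *)
Definition vertex_product (sgn : vertex G -> bool) K : pauli (Q + edge G)%type :=
  Pauli (2 * #|[set v in K | sgn v]|)%:R%R
    (sum_set (qubits_in K) (coboundary K)) set0.

Definition lift_pauli g c : pauli (Q + edge G)%type :=
  Pauli (phase g) (sum_set (xpart g) set0) (sum_set (zpart g) c).

Lemma vertex_check_product sgn v : vertex_check sgn v = vertex_product sgn [set v].
Proof.
rewrite /vertex_check /vertex_product; congr Pauli.
  by rewrite setIdE card_set1I inE; case: (sgn v).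
apply/setP => -[q|e]; rewrite !inE.
  case: insubP => [u _ <-|qS]; first by case: v => [u'|d]; rewrite !inE.
  case: v => // u; apply/negbTE/eqP => qu; move: qS; rewrite qu.
  by rewrite (valP u).
by rewrite setIC card_set1I oddb.
Qed.

Lemma cycle_check_lift j : cycle_check p j = lift_pauli 1 (p j).
Proof.
by congr Pauli; apply/setP => -[q|e]; rewrite !inE.
Qed.

Lemma deformed_check_lift i : deformed_check s mu i = lift_pauli (s i) (mu i).
Proof.
by congr Pauli; apply/setP => -[q|e]; rewrite !inE.
Qed.

Lemma vertex_product0 sgn : vertex_product sgn set0 = 1.
Proof.
rewrite pauli1E /vertex_product setIdE set0I cards0; congr Pauli.
apply/setP => -[q|e]; rewrite !inE.
  by case: insubP => // u; rewrite inE.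
by rewrite setI0 cards0.
Qed.

Lemma vertex_productD sgn K K' :
  vertex_product sgn (symdiff K K') = vertex_product sgn K * vertex_product sgn K'.
Proof.
rewrite pauliME /= set0I cards0 muln0 addr0; congr Pauli.
- rewrite -natrD -mulnDr; apply/eqP; rewrite Z4_double_eq oddD -odd_card_symdiff.
  apply/eqP; congr (odd #|pred_of_set _|).
  by apply/setP => v; rewrite !inE andb_addl.
- by rewrite sum_set_symdiff qubits_in_symdiff coboundary_symdiff.
- by rewrite symdiff0.
Qed.

Lemma vertex_product_invol sgn K : vertex_product sgn K * vertex_product sgn K = 1.
Proof. by rewrite -vertex_productD symdiffxx vertex_product0. Qed.

Lemma lift_pauliM g g' c c' :
  lift_pauli g c * lift_pauli g' c' = lift_pauli (g * g') (symdiff c c').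
Proof.
rewrite /lift_pauli !pauliME /= sum_setI card_sum_set setI0 cards0 addn0.
by rewrite !sum_set_symdiff symdiff0.
Qed.

Lemma lift_pauli1 : lift_pauli 1 set0 = 1.
Proof. by rewrite /lift_pauli pauli1E /= sum_set0. Qed.

(** Adjointness moves the edge pairing to the vertices, where commutation with all vertex checks
    says that the Z part on the qubits of [S] is the boundary of the Z part on the edges. *)
Lemma odd_vertex_product_cross P K :
  odd #|zpart P :&: sum_set (qubits_in K) (coboundary K)| =
  odd #|K :&: symdiff (vertices_in G (lpart (zpart P))) (boundary (rpart (zpart P)))|.
Proof.
rewrite [zpart P]sum_set_parts sum_setI card_sum_set oddD lpart_sum rpart_sum.
rewrite odd_cardI_symdiff setIC card_qubits_inI; congr (_ (+) _).
by rewrite setIC odd_coboundaryI.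
Qed.

Lemma lift_pauli_vertex_commute sgn g c K : boundary c = vertices_in G (zpart g) ->
  commute (lift_pauli g c) (vertex_product sgn K).
Proof.
move=> cE; apply/commuteE; rewrite odd_vertex_product_cross set0I cards0.
by rewrite lpart_sum rpart_sum cE symdiffxx setI0 cards0.
Qed.

Lemma cycle_balanced j : boundary (p j) = vertices_in G (zpart (1 : pauli Q)).
Proof. by rewrite p_cycle pauli1E vertices_in0. Qed.

Lemma deformed_commute sgn k l :
  commute (deformed_code s p mu sgn k) (deformed_code s p mu sgn l).
Proof.
suff lifts g g' c c' : commute g g' -> commute (lift_pauli g c) (lift_pauli g' c').
  case: k => [[v|j]|i]; case: l => [[v'|j']|i'];
    rewrite /= ?vertex_check_product ?cycle_check_lift ?deformed_check_lift.
  - by rewrite /commute -!vertex_productD symdiffC.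
  - by apply/commute_sym/lift_pauli_vertex_commute/cycle_balanced.
  - by apply/commute_sym/lift_pauli_vertex_commute/mu_boundary.
  - exact/lift_pauli_vertex_commute/cycle_balanced.
  - exact: lifts.
  - by apply: lifts; exact: commute_sym (commute1 _).
  - exact/lift_pauli_vertex_commute/mu_boundary.
  - by apply: lifts; exact: commute1.
  - by apply: lifts; case: s_code => sc _; exact: sc.
by move=> gg'; rewrite /commute !lift_pauliM gg' symdiffC.
Qed.

Definition stabilizer_lifts : {set pauli (Q + edge G)%type} :=
  [set P | [exists g, exists c, [&& g \in <<checks s>>,
     boundary c == vertices_in G (zpart g) & P == lift_pauli g c]]].

Lemma stabilizer_liftsP P : reflect (exists g c, [/\ g \in <<checks s>>,
     boundary c = vertices_in G (zpart g) & P = lift_pauli g c]) (P \in stabilizer_lifts).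
Proof.
rewrite inE; apply: (iffP existsP) => [[g /existsP[c /and3P[gs /eqP cE /eqP PE]]]|[g [c [gs cE PE]]]].
  by exists g, c.
by exists g; apply/existsP; exists c; rewrite gs cE PE !eqxx.
Qed.

Lemma stabilizer_liftsM P P' : P \in stabilizer_lifts -> P' \in stabilizer_lifts ->
  P * P' \in stabilizer_lifts.
Proof.
move=> /stabilizer_liftsP[g [c [gs cE ->]]] /stabilizer_liftsP[g' [c' [gs' cE' ->]]].
apply/stabilizer_liftsP; exists (g * g'), (symdiff c c').
by rewrite groupM // boundary_symdiff cE cE' -vertices_in_symdiff lift_pauliM.
Qed.

(** A normal form for the stabilizer group: vertex products square to 1, so these are the products
    of a vertex product and a balanced lift of an original stabilizer. *)
Definition deformed_elements sgn : {set pauli (Q + edge G)%type} :=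
  [set P | [exists K, vertex_product sgn K * P \in stabilizer_lifts]].

Lemma deformed_elementsP sgn P :
  reflect (exists K, vertex_product sgn K * P \in stabilizer_lifts)
    (P \in deformed_elements sgn).
Proof. by rewrite inE; exact: existsP. Qed.

Lemma stabilizer_lifts1 : 1 \in stabilizer_lifts.
Proof.
apply/stabilizer_liftsP; exists 1, set0.
by rewrite group1 boundary0 vertices_in0 lift_pauli1.
Qed.

Lemma deformed_elements_group sgn : group_set (deformed_elements sgn).
Proof.
apply/group_setP; split.
  by apply/deformed_elementsP; exists set0; rewrite vertex_product0 mulg1 stabilizer_lifts1.
move=> P P' /deformed_elementsP[K KP] /deformed_elementsP[K' KP'].
apply/deformed_elementsP; exists (symdiff K' K); rewrite vertex_productD.
have -> : vertex_product sgn K' * vertex_product sgn K * (P * P') =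
  (vertex_product sgn K * P) * (vertex_product sgn K' * P').
  rewrite -mulgA (mulgA (vertex_product sgn K)) mulgA.
  rewrite [RHS]mulgA; congr (_ * _).
  move: KP => /stabilizer_liftsP[g [c [_ cE ->]]].
  exact: commute_sym (lift_pauli_vertex_commute _ _ cE).
exact: stabilizer_liftsM.
Qed.

Lemma deformed_sub sgn :
  <<checks (deformed_code s p mu sgn)>> \subset deformed_elements sgn.
Proof.
rewrite -[deformed_elements sgn]/(gval (Group (deformed_elements_group sgn))).
rewrite gen_subG; apply/subsetP => _ /imsetP[[[v|j]|i] _ ->];
  apply/deformed_elementsP; rewrite /= ?vertex_check_product ?cycle_check_lift ?deformed_check_lift.
- by exists [set v]; rewrite vertex_product_invol stabilizer_lifts1.
- exists set0; rewrite vertex_product0 mul1g; apply/stabilizer_liftsP.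
  by exists 1, (p j); rewrite group1 cycle_balanced.
- exists set0; rewrite vertex_product0 mul1g; apply/stabilizer_liftsP.
  by exists (s i), (mu i); rewrite mem_gen ?imset_f.
Qed.

Lemma qubits_in_setT : qubits_in [set: vertex G] = S.
Proof.
apply/setP => q; rewrite !inE; case: insubP => [u -> _|/negPf ->] //.
by rewrite inE.
Qed.

(* Only the product X(S) of all vertex checks can clash with the original
   checks, and flipping one sign flips its sign. *)
Lemma deformed_stabilizer_code :
  exists sgn, stabilizer_code (deformed_code s p mu sgn).
Proof.
have [_ s_minus1] := s_code.
have [r _] : exists r : vertex G, r \in vertex G.
  by apply/card_gt0P; case: G_conn.
(* Minus the product of all vertex checks must avoid the original group. If it does not for trivial
   signs, one sign is flipped: having both signs of X(S) in the group would put -1 there. *)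
have [sgn sgnP] : exists sgn : vertex G -> bool,
    Pauli ((2 * #|[set v in setT | sgn v]|)%:R + 2)%R S set0 \notin <<checks s>>.
  have [|XS] := boolP (Pauli 2%R S set0 \in <<checks s>>); last first.
    exists (fun=> false); rewrite (_ : [set _ in _ | _] = set0) ?cards0 ?add0r //.
    by apply/setP => v; rewrite !inE.
  move=> XS; exists (pred1 r); rewrite (_ : [set _ in _ | _] = [set r]); last first.
    by apply/setP => v; rewrite !inE.
  apply: contra s_minus1 => XS'; have := groupM XS XS'.
  rewrite pauliME /= set0I !symdiffxx cards0 cards1 muln0 addr0.
  by rewrite (_ : 2 + _ = 2)%R //; apply/val_inj.
exists sgn; split; first exact: deformed_commute.
apply/negP => /(subsetP (deformed_sub sgn)) /deformed_elementsP[K].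
rewrite [_ * _](_ : _ = Pauli ((2 * #|[set v in K | sgn v]|)%:R + 2)%R
   (sum_set (qubits_in K) (coboundary K)) set0); last first.
  by rewrite pauliME /= set0I cards0 muln0 addr0 !symdiff0.
move=> /stabilizer_liftsP[g [c [gs cE]]] [phE xE zE].
(* A lift has no X on edges, so [K] is empty or everything. The first case puts -1 in the original
   group, the second contradicts [sgnP]. *)
have /(coboundary_eq0 G_conn) : coboundary K = set0.
  by have /(congr1 (@rpart _ _)) := xE; rewrite !rpart_sum.
have gx : xpart g = qubits_in K.
  by have /(congr1 (@lpart _ _)) := xE; rewrite !lpart_sum.
have gz : zpart g = set0.
  have /(congr1 (@lpart _ _)) := zE; rewrite lpart_sum => <-.
  by apply/setP => q; rewrite !inE.
have gE : g = Pauli ((2 * #|[set v in K | sgn v]|)%:R + 2)%R (qubits_in K) set0.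
  by rewrite phE -gx -gz; case: (g).
rewrite gE in gs.
case=> KE; move: gs; rewrite KE.
  rewrite setIdE set0I cards0 add0r (_ : qubits_in set0 = set0) ?(negPf s_minus1) //.
  by apply/setP => q; rewrite !inE; case: insubP => // u; rewrite inE.
by rewrite qubits_in_setT (negPf sgnP).
Qed.

Lemma logicalsP (Q' I' : finType) (s' : I' -> pauli Q') L :
  reflect (forall i, commute (s' i) L) (L \in logicals s').
Proof.
apply: (iffP centP) => [Ls i|Ls _ /imsetP[i _ ->]]; last exact/commute_sym.
by apply/commute_sym/Ls/imset_f.
Qed.

(** * Distance of the deformed code *)

Section Distance.
Variable sgn : vertex G -> bool.
Let H := <<checks (deformed_code s p mu sgn)>>.

Definition trivial_parts (X Z : {set Q + edge G}) := exists k, Pauli k X Z \in H.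

Lemma trivial_partsD X X' Z Z' : trivial_parts X Z -> trivial_parts X' Z' ->
  trivial_parts (symdiff X X') (symdiff Z Z').
Proof.
move=> [k kH] [k' kH']; have := groupM kH kH'; rewrite pauliME /= => kkH.
by eexists; exact: kkH.
Qed.

Lemma check_trivial x :
  trivial_parts (xpart (deformed_code s p mu sgn x)) (zpart (deformed_code s p mu sgn x)).
Proof.
exists (phase (deformed_code s p mu sgn x)); rewrite /H.
have := mem_gen (imset_f (deformed_code s p mu sgn) (isT : x \in predT)).
by case: (deformed_code s p mu sgn x).
Qed.

Lemma trivial_parts0 : trivial_parts set0 set0.
Proof. by exists 0%R; exact: group1. Qed.

Lemma vertex_product_trivial K :
  trivial_parts (sum_set (qubits_in K) (coboundary K)) set0.
Proof.
elim/set_symdiff_ind: K => [|v|K K' trK trK'].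
- have /(congr1 (@xpart _)) := vertex_product0 sgn.
  rewrite /= => ->; exact: trivial_parts0.
- by have := check_trivial (inl (inl v)); rewrite [deformed_code _ _ _ _ _]vertex_check_product.
- rewrite qubits_in_symdiff coboundary_symdiff -sum_set_symdiff.
  by have := trivial_partsD trK trK'; rewrite symdiff0.
Qed.

Lemma cycle_trivial c : boundary c = set0 -> trivial_parts set0 (sum_set set0 c).
Proof.
move=> /p_gen[K ->]; rewrite -/(mod2_sum p K).
elim/set_symdiff_ind: K => [|j|K K' trK trK'].
- by rewrite mod2_sum0 sum_set0; exact: trivial_parts0.
- rewrite mod2_sum1; have := check_trivial (inl (inr j)).
  by rewrite [deformed_code _ _ _ _ _]cycle_check_lift /= sum_set0.
- by have := trivial_partsD trK trK'; rewrite symdiff0 sum_set_symdiff symdiff0 -mod2_sumD.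
Qed.

(** The elements with a balanced lift among the deformed stabilizers form a group, and it contains
    every check by way of [mu]. *)
Lemma stabilizer_lift_trivial g : g \in <<checks s>> ->
  exists2 c, boundary c = vertices_in G (zpart g) &
    trivial_parts (sum_set (xpart g) set0) (sum_set (zpart g) c).
Proof.
pose M := [set g | [exists c, (boundary c == vertices_in G (zpart g)) && (lift_pauli g c \in H)]].
have M_group : group_set M.
  apply/group_setP; split.
    rewrite inE; apply/existsP; exists set0.
    by rewrite boundary0 vertices_in0 eqxx lift_pauli1 group1.
  move=> g1 g2; rewrite !inE => /existsP[c1 /andP[/eqP e1 h1]] /existsP[c2 /andP[/eqP e2 h2]].
  apply/existsP; exists (symdiff c1 c2).
  by rewrite boundary_symdiff e1 e2 -vertices_in_symdiff eqxx -lift_pauliM groupM.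
have sM : <<checks s>> \subset M.
  rewrite -[M]/(gval (Group M_group)) gen_subG; apply/subsetP => _ /imsetP[i _ ->] /=.
  rewrite inE; apply/existsP; exists (mu i); rewrite mu_boundary eqxx -deformed_check_lift.
  by apply: mem_gen; apply/imsetP; exists (inr i).
move=> /(subsetP sM); rewrite inE => /existsP[c /andP[/eqP cE cH]].
by exists c => //; exists (phase g).
Qed.

(* Cleaning an operator by the vertex checks in K removes its X part on the
   edges and leaves a logical of the original code. *)
Lemma cleaned_logical P K : P \in nontrivial_logicals (deformed_code s p mu sgn) ->
  coboundary K = rpart (xpart P) ->
  Pauli 0%R (symdiff (lpart (xpart P)) (qubits_in K)) (lpart (zpart P))
    \in nontrivial_logicals s.
Proof.
rewrite !inE => /andP[/logicalsP Plog Pnontriv] KP; apply/andP; split.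
  apply/logicalsP => i; apply/commuteE => /=.
  have := Plog (inr i) => /commuteE; rewrite [deformed_code _ _ _ _ _]deformed_check_lift /=.
  rewrite [xpart P]sum_set_parts [zpart P]sum_set_parts !sum_setI !card_sum_set.
  rewrite setI0 cards0 addn0 oddD !lpart_sum -KP => <-.
  (* The correction by [qubits_in K] pairs with the check as the coboundary of [K] pairs with
     [mu i], again by adjointness. *)
  rewrite odd_cardI_symdiff; congr (_ (+) _).
  by rewrite setIC card_qubits_inI -mu_boundary -odd_coboundaryI setIC.
apply: contra Pnontriv => /existsP[k]; rewrite scalarM /= => /stabilizer_lift_trivial[c cE trc].
suff [k' k'H] : trivial_parts (xpart P) (zpart P).
  apply/existsP; exists (k' - phase P)%R; rewrite scalarM subrK.
  by move: k'H; rewrite -/H; case: (P).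
have tr1 := trivial_partsD trc (vertex_product_trivial K).
rewrite /= in cE tr1.
(* Both chains have the boundary dictated by commutation with the vertex checks; their difference is
   a cycle, hence a product of cycle checks up to phase. *)
have cc : boundary (symdiff c (rpart (zpart P))) = set0.
  apply/setP => v; rewrite boundary_symdiff cE.
  have /commuteE := Plog (inl (inl v)).
  rewrite [deformed_code _ _ _ _ _]vertex_check_product /= set0I cards0.
  rewrite odd_vertex_product_cross => /esym/negbT.
  rewrite (_ : [set v] :&: _ = if v \in symdiff (vertices_in G (lpart (zpart P)))
       (boundary (rpart (zpart P))) then [set v] else set0); last first.
    apply/setP => w; rewrite in_setI in_set1; case: eqP => [->|/eqP/negPf wv].
      by case: ifP => _; rewrite !inE ?eqxx.
    by case: ifP => _; rewrite !inE ?wv.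
  by case: ifP => _; [rewrite cards1|rewrite inE].
have := trivial_partsD tr1 (cycle_trivial cc).
rewrite !symdiff0 !sum_set_symdiff symdiff0 -(symdiffA (lpart _)) symdiffxx symdiff0.
rewrite (symdiffA c) symdiffxx !(symdiffC set0) !symdiff0 KP.
by rewrite -!sum_set_parts.
Qed.

(** Commuting with the cycle checks means meeting every generating cycle evenly, so exactness
    applies. *)
Lemma deformed_edge_coboundary P : P \in logicals (deformed_code s p mu sgn) ->
  exists K, coboundary K = rpart (xpart P).
Proof.
move=> /logicalsP Plog.
have [|K ->] := coboundary_exact G_conn (c := rpart (xpart P)) p_gen; last by exists K.
move=> j; have /commuteE := Plog (inl (inr j)).
rewrite [deformed_code _ _ _ _ _]cycle_check_lift /= sum_set0 setI0 cards0.
rewrite [xpart P]sum_set_parts sum_setI set0I card_sum_set cards0 rpart_sum add0n.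
by move=> ->.
Qed.

Hypothesis expansion : forall K,
  minn #|qubits_in K| #|S :\: qubits_in K| <= #|coboundary K|.

Lemma deformed_distance : distance_le (distance s) (distance (deformed_code s p mu sgn)).
Proof.
suff lighter P : P \in nontrivial_logicals (deformed_code s p mu sgn) ->
    exists2 P0, P0 \in nontrivial_logicals s & weight P0 <= weight P.
  rewrite {2}/distance; case: pickP => [P1 P1in|_]; last by case: (distance s).
  case: arg_minnP => // P Pin _; have [P0 P0in P0P] := lighter P Pin.
  rewrite /distance; case: pickP => [P2 P2in|/(_ P0)]; last by rewrite P0in.
  by case: arg_minnP => // P3 _ P3min; exact: leq_trans (P3min _ P0in) P0P.
move=> Pin; have [K KP] : exists K, coboundary K = rpart (xpart P).
  by apply: deformed_edge_coboundary; move: Pin; rewrite inE => /andP[].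
(* A set and its complement have the same coboundary, so the one containing fewer qubits may be
   chosen. *)
have [K' KP' K'le] : exists2 K', coboundary K' = rpart (xpart P) &
    #|qubits_in K'| <= #|rpart (xpart P)|.
  case: (leqP #|qubits_in K| #|coboundary K|) => [le|gt].
    by exists K; rewrite // -KP.
  have KT : coboundary (symdiff K setT) = coboundary K.
    rewrite coboundary_symdiff (_ : coboundary setT = set0) ?symdiff0 //.
    apply/setP => e; rewrite !inE setIT.
    by rewrite (eqP (introT eqP (edges_card (valP e)))).
  exists (symdiff K setT); first by rewrite KT.
  rewrite -KP.
  have := expansion K; rewrite geq_min leqNgt gt /=; apply: leq_trans.
  apply/subset_leq_card/subsetP => q; rewrite qubits_in_symdiff qubits_in_setT !inE.
  by case: insubP => [u -> _|/negPf ->] //=; rewrite addbT andbT.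
exists (Pauli 0%R (symdiff (lpart (xpart P)) (qubits_in K')) (lpart (zpart P))).
  exact: cleaned_logical.
rewrite /weight [supp P in leqRHS]sum_set_parts card_sum_set.
(* Cleaning adds at most [qubits_in K'] to the support, and this is paid for by the removed X part
   on the edges. *)
apply: leq_trans (_ : #|lpart (supp P) :|: qubits_in K'| <= _).
  apply/subset_leq_card/subsetP => q; rewrite /supp !inE /=.
  by case: (inl q \in xpart P); case: (inl q \in zpart P); case: (insub q) => //= u;
    rewrite ?addbT ?orbT ?orbF.
apply: leq_trans (leq_card_setU _ _) _; rewrite leq_add2l (leq_trans K'le) //.
by apply/subset_leq_card/subsetP => e; rewrite /supp !inE => ->.
Qed.

End Distance.

End DeformedCodeTheory.

(** * Triangles and squares as cycle checks *)

Lemma set2_eq (T : finType) (a b c d : T) : [set a; b] = [set c; d] ->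
  a = c /\ b = d \/ a = d /\ b = c.
Proof.
move=> e.
have := in_set2 a c d; rewrite -e !inE eqxx /= => /esym/orP ac.
have := in_set2 b c d; rewrite -e !inE eqxx orbT /= => /esym/orP bc.
have := in_set2 c a b; rewrite e !inE eqxx /= => /esym/orP ca.
have := in_set2 d a b; rewrite e !inE eqxx orbT /= => /esym/orP da.
case: ac => /eqP ac; case: bc => /eqP bc; subst; [right|by left|by right|left].
  by case: da => /eqP ->.
by case: ca => /eqP ->.
Qed.

Lemma leq_card_bigcup (T I : finType) (A : {set I}) (F : I -> {set T}) n :
  (forall i, i \in A -> #|F i| <= n) -> #|\bigcup_(i in A) F i| <= #|A| * n.
Proof.
move=> Fn; apply: leq_trans (_ : \sum_(i in A) n <= _); last by rewrite sum_nat_const.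
elim/big_ind2: _ => [|B k B' k' Bk Bk'|i iA]; rewrite ?cards0 ?Fn //.
by rewrite (leq_trans (leq_card_setU _ _)) // leq_add.
Qed.

Section ShortCycles.
Variables (Q : finType) (S : {set Q}) (G : aux_graph S).
Implicit Types (u v w z : vertex G) (c : {set edge G}).

(* A triangle is encoded by a 4-tuple with a repeated vertex. *)
Definition short_cycle (t : 4.-tuple (vertex G)) : bool :=
  (2 < size (undup t)) && ucycleb (@adj Q S G) (undup t).

Definition short_cycle_edges (j : {t | short_cycle t}) : {set edge G} :=
  cycle_edges (undup (val j)).

Lemma link_disjoint u v w z : [set u; v] <> [set w; z] -> [disjoint link u v & link w z].
Proof.
move=> ne; rewrite -setI_eq0; apply/eqP/setP => e; rewrite !inE.
by apply/negbTE/andP => -[/eqP-> /eqP].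
Qed.

Lemma symdiff_disjointE (T : finType) (A B : {set T}) : [disjoint A & B] -> symdiff A B = A :|: B.
Proof.
move=> /pred0P AB; apply/setP => x; rewrite !inE; have := AB x; rewrite /=.
by case: (x \in A) (x \in B) => [] [].
Qed.

(** Distinct vertices give distinct edges, so the union of the links is also their sum over Z/2. *)
Lemma cycle_edges3 u v w : uniq [:: u; v; w] ->
  cycle_edges [:: u; v; w] = symdiff (link u v) (symdiff (link v w) (link w u)).
Proof.
rewrite /= !inE !negb_or => /and3P[/andP[/eqP uv /eqP uw] /eqP vw _].
have vu : (v == u) = false by apply/eqP; congruence.
have wu : (w == u) = false by apply/eqP; congruence.
have wv : (w == v) = false by apply/eqP; congruence.
have d1 : [disjoint link v w & link w u] by apply: link_disjoint => /set2_eq[][]; congruence.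
rewrite (symdiff_disjointE d1) symdiff_disjointE; last first.
  by rewrite -setI_eq0 setIUr setU_eq0 !setI_eq0 !link_disjoint // => /set2_eq[][]; congruence.
apply/setP => e; rewrite !inE; apply/existsP/or3P.
  move=> [x]; rewrite !inE => /andP[/or3P[]/eqP-> ];
    rewrite /= ?vu ?wu ?wv eqxx => ?; by [apply: Or31|apply: Or32|apply: Or33].
by case=> ee; [exists u|exists v|exists w]; rewrite !inE eqxx ?orbT /= ?vu ?wu ?wv eqxx.
Qed.

Lemma cycle_edges4 u v w z : uniq [:: u; v; w; z] ->
  cycle_edges [:: u; v; w; z] =
    symdiff (link u v) (symdiff (link v w) (symdiff (link w z) (link z u))).
Proof.
rewrite /= !inE !negb_or => /and4P[/and3P[/eqP uv /eqP uw /eqP uz] /andP[/eqP vw /eqP vz] /eqP wz _].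
have d1 : [disjoint link w z & link z u] by apply: link_disjoint => /set2_eq[][]; congruence.
have d2 : [disjoint link v w & link w z :|: link z u].
  by rewrite -setI_eq0 setIUr setU_eq0 !setI_eq0 !link_disjoint // => /set2_eq[][]; congruence.
rewrite (symdiff_disjointE d1) (symdiff_disjointE d2) symdiff_disjointE; last first.
  by rewrite -setI_eq0 !setIUr !setU_eq0 !setI_eq0 !link_disjoint // => /set2_eq[][]; congruence.
have vu : (v == u) = false by apply/eqP; congruence.
have wu : (w == u) = false by apply/eqP; congruence.
have wv : (w == v) = false by apply/eqP; congruence.
have zu : (z == u) = false by apply/eqP; congruence.
have zv : (z == v) = false by apply/eqP; congruence.
have zw : (z == w) = false by apply/eqP; congruence.
apply/setP => e; rewrite !inE; apply/existsP/or4P.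
  move=> [x]; rewrite !inE => /andP[/or4P[]/eqP-> ];
    rewrite /= ?vu ?wu ?wv ?zu ?zv ?zw eqxx => ?;
    by [apply: Or41|apply: Or42|apply: Or43|apply: Or44].
by case=> ee; [exists u|exists v|exists w|exists z];
  rewrite !inE eqxx ?orbT /= ?vu ?wu ?wv ?zu ?zv ?zw eqxx.
Qed.

Lemma card_link u v : #|link u v| <= 1.
Proof.
case: (set_0Vmem (link u v)) => [->|[e eE]]; first by rewrite cards0.
rewrite (_ : link u v = [set e]) ?cards1 //.
apply/setP => e'; move: eE; rewrite !inE => /eqP <-.
by rewrite (inj_eq val_inj).
Qed.

Lemma leq_card_symdiff (T : finType) (A B : {set T}) : #|symdiff A B| <= #|A| + #|B|.
Proof.
apply: leq_trans (leq_card_setU A B); apply/subset_leq_card/subsetP => x.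
by rewrite !inE; case: (x \in A).
Qed.

Variant short_cycle_spec (j : {t | short_cycle t}) : Prop :=
| Triangle u v w of adj u v & adj v w & adj w u &
    short_cycle_edges j = symdiff (link u v) (symdiff (link v w) (link w u))
| Square u v w z of adj u v & adj v w & adj w z & adj z u &
    short_cycle_edges j =
      symdiff (link u v) (symdiff (link v w) (symdiff (link w z) (link z u))).

Lemma short_cycleP j : short_cycle_spec j.
Proof.
have : size (undup (val j)) <= 4 by rewrite (leq_trans (size_undup _)) ?size_tuple.
have := erefl (short_cycle_edges j); rewrite {2}/short_cycle_edges.
have := undup_uniq (val j); have /andP[] := valP j.
case: (undup _) => [|u [|v [|w [|z [|y l]]]]] // _ /andP[] /=.
  move=> /and4P[uv vw wu _] _ luniq eE _.
  by apply: (Triangle uv vw wu); rewrite eE cycle_edges3.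
move=> /and5P[uv vw wz zu _] _ luniq eE _.
by apply: (Square uv vw wz zu); rewrite eE cycle_edges4.
Qed.

Lemma short_cycle_is_cycle j : is_cycle (short_cycle_edges j).
Proof. by have /andP[? /andP[? ?]] := valP j; exists (undup (val j)); split=> //; exact/andP. Qed.

Lemma short_cycle_boundary j : boundary (short_cycle_edges j) = set0.
Proof.
case: (short_cycleP j) => [u v w uv vw wu ->|u v w z uv vw wz zu ->];
  rewrite !boundary_symdiff !boundary_link; try by right.
  by rewrite !symdiff_trans symdiffxx.
by rewrite !symdiff_trans symdiffxx.
Qed.

Lemma card_short_cycle j : #|short_cycle_edges j| <= 4.
Proof.
case: (short_cycleP j) => [u v w uv vw wu ->|u v w z uv vw wz zu ->].
  apply: (@leq_trans (1 + (1 + 1))) => //.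
  by do 2 (apply: leq_trans (leq_card_symdiff _ _) _; apply: leq_add; rewrite ?card_link //).
apply: (@leq_trans (1 + (1 + (1 + 1)))) => //.
by do 3 (apply: leq_trans (leq_card_symdiff _ _) _; apply: leq_add; rewrite ?card_link //).
Qed.

Section BoundedDegree.
Variable d : nat.
Hypothesis degree : forall u, #|[set v | adj u v]| <= d.

Fixpoint ball u k : {set vertex G} :=
  if k is k'.+1 then ball u k' :|: \bigcup_(v in ball u k') [set w | adj v w] else [set u].

Lemma card_ball u k : #|ball u k| <= d.+1 ^ k.
Proof.
elim: k => [|k IHk] /=; first by rewrite cards1.
apply: leq_trans (leq_card_setU _ _) _.
apply: (@leq_trans (#|ball u k| + #|ball u k| * d)).
  by rewrite leq_add2l; apply: leq_card_bigcup.
by rewrite -mulnS expnSr leq_mul2r IHk orbT.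
Qed.

Lemma ball_sub u k k' : k <= k' -> ball u k \subset ball u k'.
Proof.
move=> /subnK <-; elim: (k' - k) => [|i IHi] //=.
exact: subset_trans IHi (subsetUl _ _).
Qed.

Lemma path_ball u v k l : v \in ball u k -> path (@adj Q S G) v l ->
  {subset v :: l <= ball u (k + size l)}.
Proof.
elim: l v k => [|w l IHl] v k vk /=.
  by move=> _ x; rewrite inE addn0 => /eqP ->.
move=> /andP[vw wl] x; rewrite inE => /orP[/eqP->|].
  by apply: (subsetP (ball_sub u (leq_addr _ k))).
have wk : w \in ball u k.+1.
  by rewrite /= inE; apply/orP; right; apply/bigcupP; exists v => //; rewrite inE.
by move/(IHl w k.+1 wk wl); rewrite addSnnS.
Qed.

(** All vertices of a short cycle through [e] lie in the ball of radius 4 around an end of [e]. The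
    inner power bounds this ball, the outer one the 4-tuples in it. *)
Lemma short_cycle_congestion e :
  #|[set j | e \in short_cycle_edges j]| <= (d.+1 ^ 4) ^ 4.
Proof.
have [v0 [v1 [_ _ eE]]] := edge_ends e.
pose B := ball v0 4.
have sub j : e \in short_cycle_edges j -> all [in B] (val (val j)).
  rewrite inE => /existsP[v /andP[vc /eqP eE']].
  have v0c : v0 \in undup (val j).
    have : v0 \in val e by rewrite eE !inE eqxx.
    by rewrite eE' !inE => /orP[]/eqP -> //; rewrite mem_next.
  have /andP[_ /andP[cyc _]] := valP j.
  have [k l lE] := rot_to v0c.
  have : path.cycle (@adj Q S G) (v0 :: l) by rewrite -lE rot_cycle.
  rewrite /= rcons_path => /andP[v0l _].
  have szl : 0 + size l <= 4.
    have : size (v0 :: l) <= 4.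
      by rewrite -lE size_rot (leq_trans (size_undup _)) // size_tuple.
    by rewrite /=; lia.
  apply/allP => x xj; apply: (subsetP (ball_sub v0 szl)).
  apply: (path_ball _ v0l); first by rewrite /= inE.
  by rewrite -lE mem_rot mem_undup.
pose F (j : {t | short_cycle t}) := [ffun i => tnth (val j) i].
have F_inj : injective F.
  by move=> j k /ffunP jk; apply/val_inj/eq_from_tnth => i; have := jk i; rewrite !ffunE.
rewrite -(card_imset _ F_inj).
have /subset_leq_card : F @: [set j | e \in short_cycle_edges j] \subset ffun_on (mem B).
  apply/subsetP => _ /imsetP[j je ->].
  apply/ffun_onP => i; rewrite ffunE; apply: (allP (sub j _)); last exact: mem_tnth.
  by move: je; rewrite inE.
by rewrite card_ffun_on card_ord => /leq_trans; apply; rewrite leq_exp2r // card_ball.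
Qed.

End BoundedDegree.
End ShortCycles.

(** * Filling cycles by short cycles *)

Section Filling.
Variables (Q : finType) (S : {set Q}) (G : aux_graph S).
Implicit Types (u v w z : vertex G) (c : {set edge G}).

(** Equality is allowed so that clamped steps and fixed points of permutations can be treated as
    edges with an empty link. *)
Definition near u v := u = v \/ adj u v.

Lemma near_sym u v : near u v -> near v u.
Proof. by case=> [->|uv]; [left|right; rewrite adj_sym]. Qed.

Definition filled c := exists K, c = mod2_sum (@short_cycle_edges Q S G) K.

Lemma filled0 : filled set0.
Proof. by exists set0; rewrite mod2_sum0. Qed.

Lemma filledD c c' : filled c -> filled c' -> filled (symdiff c c').
Proof. by move=> [K ->] [K' ->]; exists (symdiff K K'); rewrite mod2_sumD. Qed.

Lemma filled_cycle j : filled (@short_cycle_edges Q S G j).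
Proof. by exists [set j]; rewrite mod2_sum1. Qed.

Lemma short_cycle_undup (t : 4.-tuple (vertex G)) l :
  undup t = l -> 2 < size l -> uniq l -> path.cycle (@adj Q S G) l -> filled (cycle_edges l).
Proof.
move=> tl l2 lu lc; have st : short_cycle t by rewrite /short_cycle tl l2 /ucycleb lc.
by have := filled_cycle (Sub t st); rewrite /short_cycle_edges SubK tl.
Qed.

Lemma filled_triangle u v w : near u v -> near v w -> near w u ->
  filled (symdiff (link u v) (symdiff (link v w) (link w u))).
Proof.
case=> [->|uv].
  by rewrite linkxx (linkC w) symdiffxx symdiff0 => *; exact: filled0.
case=> [->|vw].
  by rewrite linkxx (linkC w) (symdiffC set0) symdiff0 symdiffxx => *; exact: filled0.
case=> [->|wu].
  by rewrite linkxx (linkC v) symdiff0 symdiffxx; exact: filled0.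
have l_uniq : uniq [:: u; v; w].
  by rewrite /= !inE (negPf (adj_neq uv)) (negPf (adj_neq vw)) eq_sym (negPf (adj_neq wu)).
rewrite -cycle_edges3 //; apply: (@short_cycle_undup [tuple u; v; w; w]) => //.
  rewrite /= !inE (negPf (adj_neq uv)) (negPf (adj_neq vw)) (eq_sym u w).
  by rewrite (negPf (adj_neq wu)) eqxx.
by rewrite /= uv vw wu.
Qed.

(** If opposite corners coincide the links cancel in pairs; if adjacent corners coincide a triangle
    remains; otherwise it is a genuine 4-cycle. *)
Lemma filled_square u v w z : near u v -> near v w -> near w z -> near z u ->
  filled (symdiff (link u v) (symdiff (link v w) (symdiff (link w z) (link z u)))).
Proof.
move=> nuv nvw nwz nzu.
have [->|uw] := eqVneq u w.
  rewrite (linkC z) symdiffxx symdiff0 (linkC v) symdiffxx; exact: filled0.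
have [->|vz] := eqVneq v z.
  rewrite (linkC w) symdiffA (symdiffC (link u z)) -symdiffA.
  rewrite (linkC u) (symdiffA (link z u)) (symdiffC (link z u)) -symdiffA symdiffxx symdiff0 symdiffxx.
  exact: filled0.
case: nuv => [uv|uv].
  by subst v; rewrite linkxx (symdiffC set0) symdiff0; apply: filled_triangle.
case: nvw => [vw|vw].
  by subst w; rewrite linkxx (symdiffC set0) symdiff0; apply: filled_triangle => //; right.
case: nwz => [wz|wz].
  by subst z; rewrite linkxx (symdiffC set0) symdiff0; apply: filled_triangle => //; right.
case: nzu => [zu|zu].
  by subst z; rewrite linkxx symdiff0; apply: filled_triangle => //; right.
have l_uniq : uniq [:: u; v; w; z].
  rewrite /= !inE (negPf (adj_neq uv)) (negPf (adj_neq vw)) (negPf (adj_neq wz)).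
  by rewrite (negPf uw) (negPf vz) eq_sym (negPf (adj_neq zu)).
rewrite -cycle_edges4 //; apply: (@short_cycle_undup [tuple u; v; w; z]) => //.
  by apply: undup_id.
by rewrite /= uv vw wz zu.
Qed.

Section Potential.
Variable T : vertex G -> {set edge G}.

(** [T v] is thought of as a path from a root to [v]; the closed chain root, [u], [v], root is asked
    to be filled. *)
Definition good u v := near u v /\ filled (symdiff (symdiff (T u) (T v)) (link u v)).

Lemma good_refl u : good u u.
Proof. by split; [left|rewrite linkxx symdiffxx symdiffxx; exact: filled0]. Qed.

Lemma good_sym u v : good u v -> good v u.
Proof. by case=> uv fuv; split; [exact: near_sym|rewrite linkC (symdiffC (T v))]. Qed.

(** The closed chain of the fourth side is the sum of those of the other three and of the square
    itself. *)
Lemma good_square u v w z : good u v -> good v w -> good w z -> near u z -> good u z.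
Proof.
move=> [nuv fuv] [nvw fvw] [nwz fwz] nuz; split=> //.
have fsq := filled_square nuv nvw nwz (near_sym nuz).
have -> : symdiff (symdiff (T u) (T z)) (link u z) =
  symdiff (symdiff (symdiff (symdiff (symdiff (T u) (T v)) (link u v))
    (symdiff (symdiff (T v) (T w)) (link v w))) (symdiff (symdiff (T w) (T z)) (link w z)))
    (symdiff (link u v) (symdiff (link v w) (symdiff (link w z) (link z u)))).
  rewrite (linkC z); apply/setP => e; rewrite !in_set.
  move: (e \in T u) (e \in T v) (e \in T w) (e \in T z).
  by case=> [] [] [] []; do 4 case: (_ == _).
exact: (filledD (filledD (filledD fuv fvw) fwz) fsq).
Qed.

(* In a cycle every vertex has even degree, so the chains T cancel and the cycle
   is the sum of the filled cycles attached to its edges. *)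
Lemma good_generates : (forall u v, adj u v -> good u v) ->
  generates_cycle_space (@short_cycle_edges Q S G).
Proof.
move=> all_good.
suff H c : filled (symdiff (mod2_sum T (boundary c)) c).
  by move=> c c0; have := H c; rewrite c0 mod2_sum0 symdiffC symdiff0.
elim/set_symdiff_ind: c => [|e|c c' fc fc'].
- by rewrite boundary0 mod2_sum0 symdiffxx; exact: filled0.
- have [u [v [uv auv eE]]] := edge_ends e.
  have -> : [set e] = link u v.
    by apply/setP => e'; rewrite !inE -eE (inj_eq val_inj).
  rewrite boundary_link; last by right.
  by rewrite mod2_sumD !mod2_sum1; have [] := all_good _ _ auv.
- rewrite boundary_symdiff mod2_sumD -symdiffA (symdiffC c) (symdiffA _ c').
  rewrite (symdiffC _ c) symdiffA.
  exact: filledD.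
Qed.

End Potential.

Section Tree.
Variables (r : vertex G) (par : vertex G -> vertex G) (rk : vertex G -> nat).
Hypothesis par_near : forall v, v != r -> near v (par v).
Hypothesis par_rk : forall v, v != r -> rk (par v) < rk v.

(** With [T v] the tree path from [v] to the root, the closed chain of a tree edge is empty. *)
Lemma tree_potential : exists T, forall v, v != r -> good T v (par v).
Proof.
(* The recursion runs on fuel; since ranks decrease along parents, any fuel above the rank gives the
   same chain. *)
pose fix Tn n v {struct n} : {set edge G} :=
  if n is n'.+1 then if v == r then set0 else symdiff (Tn n' (par v)) (link v (par v)) else set0.
have Tn_stable n n' v : rk v < n -> rk v < n' -> Tn n v = Tn n' v.
  elim: n n' v => [|n IHn] [|n'] v //= vn vn'; case: eqP => // /eqP vr.
  by have lt := par_rk vr; rewrite (IHn n') // (leq_trans lt).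
exists (fun v => Tn (rk v).+1 v) => v vr; split; first exact: par_near.
rewrite {1}/Tn -/Tn (negPf vr) (Tn_stable (rk v) (rk (par v)).+1) ?par_rk //.
rewrite -symdiffA symdiffxx.
exact: filled0.
Qed.

Lemma tree_connected : connected_graph G.
Proof.
split; first by apply/card_gt0P; exists r.
have csym : connect_sym (@adj Q S G) by apply: sym_connect_sym; exact: adj_sym.
have to_root v : connect (@adj Q S G) v r.
  elim/ltn_ind: {v}(rk v) {-2}v (erefl (rk v)) => n IH v vn.
  have [->|vr] := eqVneq v r; first exact: connect0.
  apply: connect_trans (IH _ _ (par v) erefl); last by rewrite -vn par_rk.
  by case: (par_near vr) => [<-|/connect1].
by move=> u v; apply: connect_trans (to_root u) _; rewrite csym.
Qed.

End Tree.
End Filling.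

(** * Graphs generated by finitely many maps *)

Section FunctionGraph.
Variables (Q : finType) (S : {set Q}) (D Gam : finType).
Variable h : Gam -> {q | q \in S} + D -> {q | q \in S} + D.

Definition function_edges : {set {set {q | q \in S} + D}} :=
  [set E | [exists v, exists k, (h k v != v) && (E == [set v; h k v])]].

Lemma function_edges_card E : E \in function_edges -> #|E| = 2.
Proof.
rewrite inE => /existsP[v /existsP[k /andP[hv /eqP ->]]].
by rewrite cards2 eq_sym hv.
Qed.

Definition function_graph : aux_graph S := AuxGraph function_edges_card.

Lemma function_graph_near k (v : vertex function_graph) : near v (h k v : vertex function_graph).
Proof.
case: (eqVneq (h k v) v) => [->|hv]; [by left|right].
by rewrite /adj /= inE; apply/existsP; exists v; apply/existsP; exists k; rewrite hv eqxx.
Qed.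

Lemma function_graph_adj (u v : vertex function_graph) : adj u v ->
  exists k, h k u = v \/ h k v = u.
Proof.
rewrite /adj /= inE => /existsP[w /existsP[k /andP[_ /eqP]]] /set2_eq[][-> ->]; exists k; auto.
Qed.

Hypothesis h_inj : forall k u v, h k u != u -> h k v != v -> h k u = h k v -> u = v.

(** Each generator gives [u] at most one outgoing edge and, being injective off its fixed points, at
    most one incoming edge. *)
Lemma function_graph_degree (u : vertex function_graph) :
  #|[set v | adj u v]| <= #|Gam| * 2.
Proof.
apply: leq_trans (_ : #|\bigcup_(k in [set: Gam]) (h k u |: [set v | (h k v == u) && (v != u)])| <= _).
  apply/subset_leq_card/subsetP => v; rewrite inE => uv.
  have [k hk] := function_graph_adj uv; apply/bigcupP; exists k; rewrite // !inE.
  have vu : v != u by rewrite eq_sym (adj_neq uv).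
  by case: hk => ->; rewrite eqxx // vu orbT.
apply: leq_trans (leq_card_bigcup (n := 2) _) _; last by rewrite cardsT.
move=> k _; rewrite cardsU1 (@leq_add _ _ 1 1) ?leq_b1 //.
rewrite leqNgt; apply/negP => /card_gt1P[v [w [+ + vw]]].
rewrite !inE => /andP[/eqP hv vu] /andP[/eqP hw wu]; case/eqP: vw.
by apply: (@h_inj k); rewrite ?hv ?hw // eq_sym.
Qed.

Lemma card_function_graph : #|edge function_graph| <= #|{: {q | q \in S} + D}| * #|Gam|.
Proof.
rewrite card_sig -card_prod.
apply: leq_trans (leq_imset_card (fun x => [set x.1; h x.2 x.1]) _).
apply/subset_leq_card/subsetP => E; rewrite !inE => /existsP[v /existsP[k /andP[_ /eqP ->]]].
by apply/imsetP; exists (v, k).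
Qed.

End FunctionGraph.

(** * The network and its spanning tree *)

Section Network.
Variables (Q : finType) (S : {set Q}) (m : nat) (C : finType).
Variable iota : {q | q \in S} -> {set 'I_m.+1}.
Variable P : C -> nat -> {set 'I_m.+1} -> {set 'I_m.+1}.
Hypothesis iota_inj : injective iota.
Hypothesis P_inj : forall c k, injective (P c k).
Hypothesis P_end : forall c, P c m.+1 =1 id.
Hypothesis P_step : forall c (a : 'I_m.+1) x, exists y z,
  [/\ y = x \/ y = flip a x, z = P c a.+1 y & P c a x = z \/ P c a x = flip a z].

Local Notation node := ({set 'I_m.+1} * 'I_m.+1 * 'I_m.+1)%type.
Implicit Types (x y : {set 'I_m.+1}) (a b d : 'I_m.+1).

Definition up a : 'I_m.+1 := if a < m then inord a.+1 else a.

Lemma val_up a : up a = (if a < m then a.+1 else a) :> nat.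
Proof. by rewrite /up; case: ifP => // am; rewrite inordK. Qed.

(* Generators 0 to 4: leaf edges, the two grid steps, and the crossings in the
   directions given by the row and the column; the others are the rungs, on
   column 0 only.  The grid steps are clamped, giving degenerate edges that
   function_edges discards. *)
Definition network_step (k : 'I_5 + C * bool) (v : {q | q \in S} + node) :
    {q | q \in S} + node :=
  match v with
  | inl u => if k is inl i then if i == 0 :> nat then inr (iota u, ord0, ord0) else v else v
  | inr (x, a, b) =>
      inr match k with
          | inl i =>
              match val i with
              | 1 => (x, up a, b)
              | 2 => (x, a, up b)
              | 3 => (flip a x, a, b)
              | 4 => (flip b x, a, b)
              | _ => (x, a, b)
              end
          | inr (c, e) => if b == ord0 then (P c (a + e) x, a, b) else (x, a, b)
          end
  end.

Lemma up_inj a b : up a != a -> up b != b -> up a = up b -> a = b.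
Proof.
rewrite -!val_eqE /= !val_up => + + /(congr1 val) /=; rewrite !val_up.
by case: ifP; case: ifP; rewrite ?eqxx // => _ _ _ _ [] /val_inj.
Qed.

Lemma network_step_inj k v w : network_step k v != v -> network_step k w != w ->
  network_step k v = network_step k w -> v = w.
Proof.
case: v => [u|[[x a] b]]; case: w => [u'|[[x' a'] b']] //=.
- case: k => [i|[c e]]; rewrite ?eqxx //; case: ifP; rewrite ?eqxx // => _ _ _ [/iota_inj ->] //.
- case: k => [[[|[|[|[|[|i]]]]] im]|[c e]]; rewrite ?eqxx //.
- case: k => [[[|[|[|[|[|i]]]]] im]|[c e]]; rewrite ?eqxx //.
- case: k => [[[|[|[|[|[|i]]]]] im]|[c e]] /=; rewrite ?eqxx //.
  + move=> /eqP n1 /eqP n2 [-> e ->]; rewrite (@up_inj a a') //.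
      by apply/eqP => e'; apply: n1; rewrite e'.
    by apply/eqP => e'; apply: n2; rewrite e'.
  + move=> /eqP n1 /eqP n2 [-> -> e]; rewrite (@up_inj b b') //.
      by apply/eqP => e'; apply: n1; rewrite e'.
    by apply/eqP => e'; apply: n2; rewrite e'.
  + by move=> _ _ [e1 e2 e3]; move: e1; rewrite e2 e3 => /(can_inj (flipK _)) ->.
  + by move=> _ _ [e1 e2 e3]; move: e1; rewrite e2 e3 => /(can_inj (flipK _)) ->.
  + case: (b =P ord0) => _; case: (b' =P ord0) => _; rewrite ?eqxx // => _ _ [e1 aa bb].
    by move: e1; rewrite aa bb => /P_inj ->.
Qed.

Definition network : aux_graph S := function_graph network_step.

Definition at_node x a b : vertex network := inr (x, a, b).
Definition qubit_vertex (u : {q | q \in S}) : vertex network := inl u.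

Lemma near_step k (v w : vertex network) : network_step k v = w -> near v w.
Proof. by move=> <-; exact: (@function_graph_near _ _ _ _ network_step). Qed.

Lemma near_qubit u : near (qubit_vertex u) (at_node (iota u) ord0 ord0).
Proof. exact: (@near_step (inl ord0)). Qed.

Lemma near_down x a a' b : a' = a.+1 :> nat -> near (at_node x a b) (at_node x a' b).
Proof.
move=> aa'; apply: (@near_step (inl (inord 1))) => /=; rewrite inordK //; congr (inr (_, _, _)).
by apply: val_inj; rewrite /= val_up; have := ltn_ord a'; rewrite aa' ltnS => ->.
Qed.

Lemma near_right x a b b' : b' = b.+1 :> nat -> near (at_node x a b) (at_node x a b').
Proof.
move=> bb'; apply: (@near_step (inl (inord 2))) => /=; rewrite inordK //; congr (inr (_, _)).
by apply: val_inj; rewrite /= val_up; have := ltn_ord b'; rewrite bb' ltnS => ->.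
Qed.

Lemma near_cross_row x a b : near (at_node x a b) (at_node (flip a x) a b).
Proof. by apply: (@near_step (inl (inord 3))) => /=; rewrite inordK. Qed.

Lemma near_cross_col x a b : near (at_node x a b) (at_node (flip b x) a b).
Proof. by apply: (@near_step (inl (inord 4))) => /=; rewrite inordK. Qed.

Lemma near_rung c (e : bool) x a : near (at_node x a ord0) (at_node (P c (a + e) x) a ord0).
Proof. exact: (@near_step (inr (c, e))). Qed.

(** An arbitrary direction of [x]; the default 0 sends the tree over the empty set towards the
    root. *)
Definition top x : 'I_m.+1 := odflt ord0 [pick i in x].

Lemma topP x : x != set0 -> top x \in x.
Proof.
case/set0Pn => i ix; rewrite /top; case: pickP => [//|/(_ i)].
by rewrite ix.
Qed.

(* Inside a grid, move to column 0, then to the level of a chosen direction of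
   x, and remove that direction. *)
Definition parent (v : vertex network) : vertex network :=
  match v with
  | inl u => at_node (iota u) ord0 ord0
  | inr (x, a, b) =>
      if 0 < b then at_node x a (inord b.-1)
      else if a < top x then at_node x (inord a.+1) b
      else if top x < a then at_node x (inord a.-1) b
      else at_node (flip a x) a b
  end.

(** The two truncated differences add up to the distance from row [a] to row [top x]. The factor
    [m.+2] makes the loss of a direction outweigh any new such distance. *)
Definition node_rank (v : node) : nat :=
  let: (x, a, b) := v in b + (a - top x) + (top x - a) + #|x| * m.+2.

Definition vertex_rank (v : vertex network) : nat :=
  match v with inl u => (node_rank (iota u, ord0, ord0)).+1 | inr v => node_rank v end.

Definition root : vertex network := at_node set0 ord0 ord0.

Lemma top0 : top set0 = ord0.
Proof. by rewrite /top; case: pickP => // i; rewrite inE. Qed.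

Lemma card_flip a x : a \in x -> #|x| = #|flip a x|.+1.
Proof.
move=> ax; rewrite (cardsD1 a x) ax (_ : flip a x = x :\ a) //.
by apply/setP => b; rewrite in_flip !inE; case: eqP => [->|]; rewrite ?ax ?addbF.
Qed.

Lemma parent_cross x a b : at_node x a b != root -> (0 < b) = false -> (a < top x) = false ->
  (top x < a) = false -> a = top x /\ a \in x.
Proof.
move=> vr b0 ta at_.
have aE : a = top x by apply: val_inj => /=; lia.
split=> //; rewrite aE; apply: topP; apply: contraNneq vr => x0.
rewrite /root /at_node x0 aE x0 top0 (_ : b = ord0) //.
by apply: val_inj => /=; lia.
Qed.

Lemma parent_near v : v != root -> near v (parent v).
Proof.
case: v => [u|[[x a] b]] /=; first by move=> _; exact: near_qubit.
move=> vr; case: ifP => [b0|b0].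
  by apply/near_sym/near_right; have lt_m := ltn_ord b; rewrite inordK; lia.
case: ifP => [ta|ta].
  by apply: near_down; have lt_m := ltn_ord (top x); rewrite inordK; lia.
case: ifP => [at_|at_]; last exact: near_cross_row.
by apply/near_sym/near_down; have lt_m := ltn_ord a; rewrite inordK; lia.
Qed.

Lemma parent_rank v : v != root -> vertex_rank (parent v) < vertex_rank v.
Proof.
case: v => [u|[[x a] b]] //= vr; case: ifP => [b0|b0] /=.
  by have lt_m := ltn_ord b; rewrite inordK; lia.
case: ifP => [ta|ta] /=.
  by have lt_m := ltn_ord (top x); rewrite inordK; lia.
case: ifP => [at_|at_] /=.
  by have lt_m := ltn_ord a; rewrite inordK; lia.
have [aE ax] := parent_cross vr b0 ta at_.
rewrite (card_flip ax) mulSn; have := ltn_ord (top (flip a x)); have := ltn_ord a.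
by move: (#|flip a x| * m.+2) (nat_of_ord (top _)) => N t; lia.
Qed.

Lemma network_connected : connected_graph network.
Proof. exact: tree_connected parent_near parent_rank. Qed.

(** * All cycles of the network are filled *)

Section Filling.
Variable T : vertex network -> {set edge network}.
Hypothesis T_tree : forall v, v != root -> good T v (parent v).

Lemma at_node_neq_root x a b : (0 < a) || (0 < b) || (x != set0) -> at_node x a b != root.
Proof.
by case/orP => [/orP[]|] H; apply/eqP => -[xE aE bE]; move: H; rewrite ?xE ?aE ?bE ?eqxx.
Qed.

Lemma good_right x a b b' : b' = b.+1 :> nat -> good T (at_node x a b') (at_node x a b).
Proof.
move=> bb'; have /T_tree : at_node x a b' != root by rewrite at_node_neq_root // bb' orbT.
rewrite /= bb' /= (_ : inord b = b) //.
by apply: val_inj; rewrite /= inordK.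
Qed.

(** On column 0 these are tree edges, pointing towards level [top x]; the other columns follow by
    sliding across grid squares. *)
Lemma good_down x a a' b : a' = a.+1 :> nat -> good T (at_node x a b) (at_node x a' b).
Proof.
move=> aa'; have [n nb] : exists n : nat, n = b by exists b.
elim: n b nb => [|n IHn] b nb.
  have -> : b = ord0 by apply: val_inj.
  case: (ltnP a (top x)) => atop.
    have /T_tree : at_node x a ord0 != root.
      by rewrite at_node_neq_root //; apply/orP; right; apply: contraTneq atop => ->; rewrite top0.
    rewrite /= atop (_ : inord a.+1 = a') //.
    by apply: val_inj; rewrite /= inordK -?aa'.
  have /T_tree : at_node x a' ord0 != root by rewrite at_node_neq_root // aa'.
  rewrite /= aa' ltnNge (leq_trans atop) //= ltnS atop /= (_ : inord a = a); first exact: good_sym.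
  by apply: val_inj; rewrite /= inordK.
have nm : n < m.+1 by have := ltn_ord b; lia.
have bE : b = (Ordinal nm).+1 :> nat by rewrite -nb.
apply: good_square (good_right _ _ bE) (IHn (Ordinal nm) erefl) _ (near_down _ _ aa').
exact/good_sym/good_right.
Qed.

Lemma ord_steps (Pr : 'I_m.+1 -> Prop) :
  (forall a a', a' = a.+1 :> nat -> Pr a <-> Pr a') -> forall a a', Pr a -> Pr a'.
Proof.
move=> step; suff to0 a : Pr a <-> Pr ord0 by move=> a a' pa; apply/(to0 a')/(to0 a).
have [n na] : exists n : nat, n = a by exists a.
elim: n a na => [|n IHn] a na; first by have -> : a = ord0 by apply: val_inj.
have nm : n < m.+1 by have := ltn_ord a; lia.
have aE : a = (Ordinal nm).+1 :> nat by rewrite -na.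
by rewrite -(IHn (Ordinal nm) erefl); split=> /(step _ _ aE).
Qed.

(** Neighbouring copies of a crossing are opposite sides of a square whose other two sides are good
    grid edges. *)
Lemma good_cross_row x d b b' : good T (at_node x d b) (at_node (flip d x) d b) ->
  good T (at_node x d b') (at_node (flip d x) d b').
Proof.
apply: (ord_steps (Pr := fun b => good T (at_node x d b) (at_node (flip d x) d b))) => c c' cc'.
have gr := good_right _ _ cc'; split=> gc.
  exact: good_square (gr x d) gc (good_sym (gr _ d)) (near_cross_row _ _ _).
exact: good_square (good_sym (gr x d)) gc (gr _ d) (near_cross_row _ _ _).
Qed.

Lemma good_cross_col x d a a' : good T (at_node x a d) (at_node (flip d x) a d) ->
  good T (at_node x a' d) (at_node (flip d x) a' d).
Proof.
apply: (ord_steps (Pr := fun a => good T (at_node x a d) (at_node (flip d x) a d))) => c c' cc'.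
have gd := good_down _ _ cc'; split=> gc.
  exact: good_square (good_sym (gd x d)) gc (gd _ d) (near_cross_col _ _ _).
exact: good_square (gd x d) gc (good_sym (gd _ d)) (near_cross_col _ _ _).
Qed.

Definition good_cross x d := good T (at_node x d ord0) (at_node (flip d x) d ord0).

Lemma good_cross_rowP x d b : good_cross x d <-> good T (at_node x d b) (at_node (flip d x) d b).
Proof. by split; exact: good_cross_row. Qed.

Lemma good_cross_colP x d a : good_cross x d <-> good T (at_node x a d) (at_node (flip d x) a d).
Proof.
by rewrite (good_cross_rowP x d d); split; exact: good_cross_col.
Qed.

Lemma good_cross_sym x d : good_cross x d -> good_cross (flip d x) d.
Proof. by rewrite /good_cross flipK; exact: good_sym. Qed.

(** At grid position [(d, d')] both directions can be crossed, so the hypercube square at [x] is a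
    4-cycle there; the crossings are slid to that position. *)
Lemma good_cross_square x d d' : good_cross x d -> good_cross (flip d x) d' ->
  good_cross (flip d' x) d -> good_cross x d'.
Proof.
rewrite (good_cross_rowP x d d') (good_cross_colP (flip d x) d' d).
rewrite (good_cross_rowP (flip d' x) d d') (good_cross_colP x d' d) flipC => g1 g2 g3.
exact: good_square g1 g2 (good_sym g3) (near_cross_col _ _ _).
Qed.

Lemma good_cross_top x : x != set0 -> good_cross x (top x).
Proof.
move=> x0; have /T_tree : at_node x (top x) ord0 != root.
  by rewrite at_node_neq_root // x0 orbT.
by rewrite /= !ltnn.
Qed.

(** By induction on the size of a set containing the direction: its [top] crossing is a tree edge,
    and any other direction is the fourth side of a hypercube square whose remaining sides start
    there or at smaller sets. *)
Lemma all_good_cross x d : good_cross x d.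
Proof.
suff H y : d \in y -> good_cross y d.
  case: (boolP (d \in x)) => [/H //|dx].
  rewrite -(flipK d x); apply/good_cross_sym/H.
  by rewrite in_flip eqxx (negPf dx).
have [n yn] : exists n, n = #|y| by exists #|y|.
elim: n y d yn => [|n IHn] y e yn ey.
  by move: yn => /esym/cards0_eq y0; rewrite y0 inE in ey.
have y0 : y != set0 by apply/set0Pn; exists e.
have [->|et] := eqVneq e (top y); first exact: good_cross_top.
have ty := topP y0.
apply: (good_cross_square (good_cross_top y0)).
  apply: IHn; first by apply: succn_inj; rewrite -(card_flip ty).
  by rewrite in_flip ey (negPf et).
apply: IHn; first by apply: succn_inj; rewrite -(card_flip ey).
by rewrite in_flip ty eq_sym (negPf et).
Qed.

Lemma good_cross_at_row x a b : good T (at_node x a b) (at_node (flip a x) a b).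
Proof. by apply/good_cross_rowP/all_good_cross. Qed.

Lemma good_cross_at_col x a b : good T (at_node x a b) (at_node (flip b x) a b).
Proof. by apply/good_cross_colP/all_good_cross. Qed.

(* The rungs are filled from the bottom level, where the residual permutation
   is the identity, upwards. *)
Lemma good_rung c (e : bool) x a :
  good T (at_node x a ord0) (at_node (P c (a + e) x) a ord0).
Proof.
(* One Benes step: the rung for [P c a0] closes a square formed by a rung for [P c a0.+1] and at
   most one crossing at each end. *)
have cross (a0 : 'I_m.+1) : (forall x, good T (at_node x a0 ord0) (at_node (P c a0.+1 x) a0 ord0)) ->
    forall x, good T (at_node x a0 ord0) (at_node (P c a0 x) a0 ord0).
  move=> gS y; have [y' [z [yy' zE zy]]] := P_step c a0 y.
  have g1 : good T (at_node y a0 ord0) (at_node y' a0 ord0).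
    by case: yy' => ->; [exact: good_refl|exact: good_cross_at_row].
  have g3 : good T (at_node z a0 ord0) (at_node (P c a0 y) a0 ord0).
    by case: zy => ->; [exact: good_refl|exact: good_cross_at_row].
  apply: good_square g1 _ g3 _; first by rewrite zE.
  by have := near_rung c false y a0; rewrite addn0.
suff H : forall x, good T (at_node x a ord0) (at_node (P c a.+1 x) a ord0).
  by case: e; rewrite ?addn1 ?addn0; [|exact: cross].
have [n na] : exists n, a + n = m by exists (m - a); have := ltn_ord a; lia.
elim: n a na {x e} => [|n IHn] a' na x.
  by rewrite -(addn0 a') na P_end; exact: good_refl.
have a'm : a'.+1 < m.+1 by lia.
have aA : Ordinal a'm = a'.+1 :> nat by [].
(* Consecutive levels both carry rungs for [P c a'.+1], with [e] true above and false below, so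
   goodness climbs through a square with two vertical sides. *)
have g2 := cross (Ordinal a'm) (IHn (Ordinal a'm) _) x.
apply: good_square (good_down _ _ aA) (g2 _) (good_sym (good_down _ _ aA)) _; first by rewrite /=; lia.
by have := near_rung c true x a'; rewrite addn1.
Qed.

Lemma good_step k (v : vertex network) : good T v (network_step k v).
Proof.
case: v => [u|[[x a] b]] /=.
  case: k => [i|_]; last exact: good_refl.
  case: ifP => _; last exact: good_refl.
  exact: (@T_tree (inl u)).
have gup : good T (at_node x a b) (at_node x (up a) b).
  rewrite /up; case: ifP => am; last exact: good_refl.
  by apply: good_down; rewrite inordK.
have gup' : good T (at_node x a b) (at_node x a (up b)).
  rewrite /up; case: ifP => bm; last exact: good_refl.
  by apply/good_sym/good_right; rewrite inordK.
case: k => [[[|[|[|[|[|i]]]]] im]|[c e]] //=; try exact: good_refl.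
- exact: good_cross_at_row.
- exact: good_cross_at_col.
- case: eqP => [->|_]; [exact: good_rung|exact: good_refl].
Qed.

End Filling.

Lemma network_generates : generates_cycle_space (@short_cycle_edges Q S network).
Proof.
have [T T_tree] := tree_potential parent_near parent_rank.
apply: (@good_generates _ _ _ T) => u v /function_graph_adj[k [<-|<-]].
  exact: good_step.
exact/good_sym/good_step.
Qed.

(** * Expansion of the network *)

Section Expansion.
Variable K : {set vertex network}.

Definition crossing_index : finType := ({q | q \in S} + ('I_m.+1 * {set 'I_m.+1}) * bool)%type.

Definition crossing_edge (i : crossing_index) : {set vertex network} :=
  match i with
  | inl u => [set qubit_vertex u; at_node (iota u) ord0 ord0]
  | inr (a, x, true) => [set at_node x a ord0; at_node x (up a) ord0]
  | inr (a, x, false) => [set at_node x a ord0; at_node (flip a x) a ord0]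
  end.

(** Whether the leaf, descent or cross edge with index [i] is cut by [K]; the condition [a \notin x]
    selects one end of each cross edge. *)
Definition crossing (i : crossing_index) : bool :=
  match i with
  | inl u => (qubit_vertex u \in K) (+) (at_node (iota u) ord0 ord0 \in K)
  | inr (a, x, true) => (at_node x a ord0 \in K) (+) (at_node x (up a) ord0 \in K)
  | inr (a, x, false) => (a \notin x) &&
      ((at_node x a ord0 \in K) (+) (at_node (flip a x) a ord0 \in K))
  end.

Lemma crossing_up x a : (at_node x a ord0 \in K) (+) (at_node x (up a) ord0 \in K) -> up a = a.+1 :> nat.
Proof. by rewrite val_up; case: ifP => // am; rewrite /up am addbb. Qed.

(** Restricting to cut edges discards the clamped descent at the last level, which is degenerate. *)
Lemma crossing_edge_inj : {in [pred i | crossing i] &, injective crossing_edge}.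
Proof.
move=> [u|[[a x] e]] [u'|[[a' x'] e']]; rewrite !inE /=.
- by move=> _ _ /set2_eq[][] // [->].
- by case: e' => _ _ /set2_eq[][].
- by case: e => _ _ /set2_eq[][].
- case: e; case: e' => /=.
  + move=> /crossing_up ua /crossing_up ua' /set2_eq[][[xx aa] [_ uu]]; first by rewrite xx aa.
    by have := congr1 val aa; have := congr1 val uu; rewrite /= ua ua'; lia.
  + move=> _ _ /set2_eq[][[xx aa] [xx' _]].
      by have /eqP := flip_neq a' x'; rewrite -xx' xx.
    by have /eqP := flip_neq a' x'; rewrite -xx xx'.
  + move=> _ _ /set2_eq[][[xx aa] [xx' _]].
      by have /eqP := flip_neq a x; rewrite xx' xx.
    by have /eqP := flip_neq a x; rewrite xx' xx.
  + move=> /andP[ax _] /andP[ax' _] /set2_eq[][[xx aa] _]; first by rewrite xx aa.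
    by move: ax; rewrite xx aa in_flip eqxx (negPf ax').
Qed.

Lemma crossing_le : #|[set i | crossing i]| <= #|coboundary K|.
Proof.
rewrite -(card_in_imset (f := crossing_edge)); last first.
  by move=> i j; rewrite !inE => ci cj; apply: crossing_edge_inj.
rewrite -(card_imset _ (val_inj : injective (val : edge network -> _))).
apply/subset_leq_card/subsetP => _ /imsetP[i ci ->].
suff [v [w [vw eE odd_vw]]] : exists v w,
    [/\ near v w, crossing_edge i = [set v; w] & (v \in K) (+) (w \in K)].
  have {vw} avw : adj v w by case: vw odd_vw => // ->; rewrite addbb.
  apply/imsetP; exists (Sub [set v; w] avw : edge network) => //.
  by rewrite inE /= odd_cards2I // adj_neq.
move: ci; rewrite inE; case: i => [u|[[a x] [|]]] /=.
- by move=> ?; exists (qubit_vertex u), (at_node (iota u) ord0 ord0); split=> //; exact: near_qubit.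
- move=> ci; exists (at_node x a ord0), (at_node x (up a) ord0); split=> //.
  by apply: near_down; exact: crossing_up ci.
- move=> /andP[_ ?]; exists (at_node x a ord0), (at_node (flip a x) a ord0); split=> //.
  exact: near_cross_row.
Qed.

Local Open Scope ring_scope.

(** The indicator of [K] on level [k] of column 0. Capping at [m] repeats the last level, so its
    descent costs nothing. *)
Definition level (k : nat) x : rat := (at_node x (inord (minn k m)) ord0 \in K)%:R.

Lemma bool_dist (b c : bool) : `|b%:R - c%:R| = (b (+) c)%:R :> rat.
Proof. by case: b; case: c. Qed.

(** Each pair of neighbours in direction [a] is represented by its member avoiding [a]. *)
Lemma sum_half (a : 'I_m.+1) (g : {set 'I_m.+1} -> rat) : (forall x, g (flip a x) = g x) ->
  \sum_x g x / 2 = \sum_(x : {set 'I_m.+1}) (a \notin x)%:R * g x.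
Proof.
move=> gI; have e : \sum_(x : {set 'I_m.+1}) (a \notin x)%:R * g x =
    \sum_(x : {set 'I_m.+1}) (a \in x)%:R * g x.
  rewrite -(sum_flip a (fun x : {set 'I_m.+1} => (a \notin x)%:R * g x)); apply: eq_bigr => x _.
  by rewrite gI in_flip eqxx addbT negbK.
have : \sum_x g x = \sum_(x : {set 'I_m.+1}) (a \notin x)%:R * g x +
    \sum_(x : {set 'I_m.+1}) (a \in x)%:R * g x.
  rewrite -big_split; apply: eq_bigr => x _ /=.
  by case: (a \in x); rewrite ?mul0r ?mul1r ?add0r ?addr0.
rewrite -mulr_suml -e => ->; by field.
Qed.

Lemma crossing_card : (#|[set i | crossing i]|%:R : rat) =
  \sum_u `|(qubit_vertex u \in K)%:R - level 0 (iota u)| + \sum_(a < m.+1) variation level a.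
Proof.
rewrite -sum1_card natr_sum big_mkcond /=.
rewrite (eq_bigr (fun i => (crossing i)%:R)); last by move=> i _; rewrite inE; case: crossing.
rewrite big_sumType /=; congr (_ + _).
  apply: eq_bigr => u _; rewrite /level bool_dist min0n.
  by rewrite (_ : inord 0 = ord0) //; apply: val_inj; rewrite /= inordK.
rewrite (eq_bigr (fun i => (crossing (inr (i.1, i.2)))%:R)); last by case.
rewrite -(pair_bigA _ (fun p e => (crossing (inr (p, e)))%:R)) /=.
rewrite (eq_bigr (fun p => \sum_e (crossing (inr (p.1, p.2, e)))%:R)); last by case.
rewrite -(pair_bigA _ (fun a x => \sum_e (crossing (inr (a, x, e)))%:R)) /=.
apply: eq_bigr => a _; rewrite /variation.
have lE k : (k <= m)%N -> inord (minn k m) = inord k :> 'I_m.+1 by move=> /minn_idPl ->.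
have aE : inord a = a by apply: val_inj; rewrite /= inordK.
have lev x : level a x = (at_node x a ord0 \in K)%:R.
  by rewrite /level lE ?aE // -ltnS.
have levS x : level a.+1 x = (at_node x (up a) ord0 \in K)%:R.
  rewrite /level (_ : inord _ = up a) //; apply: val_inj; rewrite /= val_up inordK.
    by have := ltn_ord a; case: ifP; lia.
  by rewrite ltnS geq_minr.
rewrite aE (sum_half (a := a)) => [|x]; last by rewrite flipK distrC.
rewrite -big_split; apply: eq_bigr => x _ /=.
rewrite big_bool /= !lev levS !bool_dist addrC; congr (_ + _).
by case: (a \in x); rewrite ?mul0r ?mul1r.
Qed.

(** Cut leaf and butterfly edges together bound the L1 distance from the indicator of [K] on the
    qubits to a constant t in [0,1], and this distance is at least the smaller side. *)
Lemma network_expansion :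
  (minn #|qubits_in K| #|S :\: qubits_in K| <= #|coboundary K|)%N.
Proof.
apply: leq_trans crossing_le; rewrite -(ler_nat rat) crossing_card.
have level01 k x : 0 <= level k x <= 1 by rewrite /level; case: (_ \in _); rewrite ?lexx ?ler01.
have [t /andP[t0 t1] tle] := cube_expansion level01.
pose A := [set u | qubit_vertex u \in K].
have -> : qubits_in K = val @: A.
  apply/setP => q; rewrite inE; apply/idP/imsetP => [|[u uA ->]].
    by case: insubP => // u _ <- uK; exists u; rewrite ?inE.
  by rewrite valK; rewrite inE in uA.
have -> : S :\: val @: A = val @: (~: A).
  apply/setP => q; rewrite inE; apply/andP/imsetP => [[qA qS]|[u uA ->]].
    exists (Sub q qS); rewrite // inE; apply: contra qA => uA.
    by apply/imsetP; exists (Sub q qS).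
  by rewrite (valP u) mem_imset -?in_setC //; exact: val_inj.
rewrite !card_imset; try exact: val_inj.
(* Triangle inequality through the node carrying the leaf; as [iota] is injective, the sum over
   qubits is part of the sum over the hypercube. *)
have le_t : \sum_u `|(qubit_vertex u \in K)%:R - t| <=
    \sum_u `|(qubit_vertex u \in K)%:R - level 0 (iota u)| + \sum_(a < m.+1) variation level a.
  apply: (@le_trans _ _ (\sum_u `|(qubit_vertex u \in K)%:R - level 0 (iota u)| +
      \sum_u `|level 0 (iota u) - t|)).
    rewrite -big_split; apply: ler_sum => u _ /=.
    by apply: le_trans (ler_normD _ _); rewrite subrKA.
  rewrite lerD2l; apply: le_trans tle.
  rewrite -(big_imset (fun x => `|level 0 x - t|) (in2W iota_inj) (A := predT)) /=.
  rewrite [leRHS](bigID (mem (iota @: predT))) /= lerDl.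
  by apply: sumr_ge0 => x _.
apply: le_trans le_t.
(* The distance splits into [1 - t] for each qubit of [A] and [t] for each other one, a convex
   combination of the two cardinalities. *)
rewrite (bigID (mem A)) /=.
rewrite (eq_bigr (fun=> 1 - t)); last first.
  by move=> u; rewrite inE => ->; rewrite ger0_norm // subr_ge0.
rewrite [X in _ + X](eq_bigr (fun=> t)); last first.
  by move=> u; rewrite inE => /negPf ->; rewrite sub0r normrN ger0_norm.
rewrite [X in _ + X](eq_bigl [in ~: A]); last by move=> u; rewrite !inE.
rewrite !sumr_const.
rewrite -[(1 - t) *+ _]mulr_natr -[t *+ _]mulr_natr.
have : (minn #|A| #|~: A|)%:R <= (#|A|%:R : rat) by rewrite ler_nat geq_minl.
have : (minn #|A| #|~: A|)%:R <= (#|~: A|%:R : rat) by rewrite ler_nat geq_minr.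
set p := (minn _ _)%:R; set q := #|A|%:R; set r := #|~: A|%:R; nra.
Qed.

End Expansion.

(** * Edge sets for the deformed checks *)

Section LocalPaths.
Variable conn : rel {q | q \in S}.
Hypothesis conn_near : forall u v, conn u v ->
  near (at_node (iota u) ord0 ord0) (at_node (iota v) ord0 ord0).

Definition local_path u v : {set edge network} :=
  symdiff (link (qubit_vertex u) (at_node (iota u) ord0 ord0))
   (symdiff (link (at_node (iota u) ord0 ord0) (at_node (iota v) ord0 ord0))
     (link (at_node (iota v) ord0 ord0) (qubit_vertex v))).

(** Consecutive qubits are paired and joined by three-link paths, so an even list is exactly the
    boundary. *)
Fixpoint local_matching (l : seq {q | q \in S}) : {set edge network} :=
  if l is u :: v :: l' then symdiff (local_path u v) (local_matching l') else set0.

Lemma local_matching_ind (Pr : seq {q | q \in S} -> Prop) :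
  Pr [::] -> (forall u, Pr [:: u]) -> (forall u v l, Pr l -> Pr [:: u, v & l]) ->
  forall l, Pr l.
Proof.
move=> P0 P1 P2 l; have [n] := ubnP (size l).
by elim: n l => [|n IHn] [|u [|v l]] //= ln; apply/P2/IHn; lia.
Qed.

Lemma local_matching_boundary l : uniq l -> ~~ odd (size l) ->
  {in l &, forall u v, conn u v} ->
  boundary (local_matching l) = [set qubit_vertex u | u in l].
Proof.
elim/local_matching_ind: l => [|u|u v l IHl] //=.
  by move=> _ _ _; rewrite boundary0; apply/setP => w; rewrite inE; apply/esym/negbTE/imsetP => -[].
rewrite inE negb_or negbK => /andP[/andP[uv ul] /andP[vl l_uniq]] l_even lc.
rewrite boundary_symdiff IHl //; last first.
  by move=> x y xl yl; apply: lc; rewrite !inE ?xl ?yl !orbT.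
have nuv : conn u v by apply: lc; rewrite !inE eqxx ?orbT.
rewrite !boundary_symdiff !boundary_link; last first.
- exact: near_qubit.
- exact: conn_near.
- exact/near_sym/near_qubit.
rewrite !symdiff_trans; apply/setP => w.
have inl_mem (A : {pred {q | q \in S}}) t : (qubit_vertex t \in [set qubit_vertex u | u in A]) =
      (t \in A).
  by rewrite mem_imset // => ? ? [].
have inr_mem (A : {pred {q | q \in S}}) n : (inr n \in [set qubit_vertex u | u in A]) = false.
  by apply/negbTE/imsetP => -[].
case: w => [t|n]; last by rewrite !in_set !inr_mem !in_set1.
rewrite in_set in_set !in_set1 !(inl_mem _ t) !inE !(inj_eq (@inl_inj _ _)).
have [->|tu] := eqVneq t u; first by rewrite (negPf uv) (negPf ul).
by have [->|tv] := eqVneq t v; first by rewrite (negPf vl).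
Qed.

(** Bounds the congestion: an edge has two ends, and each determines at most one qubit [u]. *)
Lemma local_matching_sub l e : e \in local_matching l ->
  exists2 u, u \in l & at_node (iota u) ord0 ord0 \in val e.
Proof.
elim/local_matching_ind: l => [|u|u v l IHl] /=; rewrite ?inE //.
case: (boolP (e \in local_matching l)) => [/IHl[w wl we] _|_].
  by exists w; rewrite // !inE wl !orbT.
rewrite addbF => H.
have : [|| val e == [set qubit_vertex u; at_node (iota u) ord0 ord0],
  val e == [set at_node (iota u) ord0 ord0; at_node (iota v) ord0 ord0] |
  val e == [set at_node (iota v) ord0 ord0; qubit_vertex v]].
  by move: H; do 3 case: (val e == _).
case/or3P => /eqP eE.
- by exists u; rewrite ?eE !inE eqxx ?orbT.
- by exists u; rewrite ?eE !inE eqxx ?orbT.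
- by exists v; rewrite ?eE !inE eqxx ?orbT.
Qed.

Lemma card_local_matching l : #|local_matching l| <= 3 * size l.
Proof.
elim/local_matching_ind: l => [|u|u v l IHl] /=; rewrite ?cards0 //.
apply: leq_trans (leq_card_symdiff _ _) _.
apply: (@leq_trans (3 + 3 * size l)); last by lia.
rewrite leq_add //; apply: (@leq_trans (1 + (1 + 1))) => //.
by do 2 (apply: leq_trans (leq_card_symdiff _ _) _; apply: leq_add; rewrite ?card_link //).
Qed.

End LocalPaths.
End Network.

(** * Weights and degrees of the deformed code *)

Section DeformedLdpc.
Variables (Q : finType) (S : {set Q}) (G : aux_graph S) (I J : finType).
Variables (s : I -> pauli Q) (p : J -> {set edge G}) (mu : I -> {set edge G}).

Lemma qubit_vertex_check_le sgn q :
  #|[set v : vertex G | inl q \in supp (vertex_check sgn v)]| <= 1.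
Proof.
rewrite leqNgt; apply/negP => /card_gt1P[v [w [+ + /eqP[]]]].
rewrite /supp !inE !orbF; case: v => // u; case: w => // u' /eqP qu /eqP qu'.
by congr inl; apply: val_inj; rewrite -qu -qu'.
Qed.

Lemma deformed_ldpc (w D d B A : nat) sgn :
  ldpc s w D ->
  (forall v : vertex G, #|[set u | adj v u]| <= d) ->
  (forall j, #|p j| <= 4) -> (forall e, #|[set j | e \in p j]| <= B) ->
  (forall i, #|mu i| <= A) -> (forall e, #|[set i | e \in mu i]| <= D * 2) ->
  ldpc (deformed_code s p mu sgn) (d + w + A + 5) (D * 2 + B + 3).
Proof.
move=> [sw sD] deg p4 pB muA muD; split.
  case=> [[v|j]|i]; rewrite /weight [supp _]sum_set_parts card_sum_set /=.
  - apply: (@leq_trans (1 + d)); last by lia.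
    apply: leq_add.
      rewrite leqNgt; apply/negP => /card_gt1P[q [q' [+ + /eqP[]]]].
      by rewrite /supp !inE !orbF; case: v => // u /eqP -> /eqP ->.
    apply: leq_trans (deg v).
    (* The opposite end maps the edges at [v] injectively to the neighbours of [v]. *)
    pose other (e : edge G) := odflt v [pick u in val e :\ v].
    have otherP (e : edge G) : v \in val e -> val e = [set v; other e] /\ adj v (other e).
      move=> ve; have [x [y [xy axy eE]]] := edge_ends e.
      rewrite /other eE; move: ve; rewrite eE !inE => /orP[]/eqP vE; case: pickP => [z|/= no].
      + rewrite !inE vE => /andP[zx /orP[/eqP zx'|/eqP ->]] //=; first by rewrite zx' eqxx in zx.
      + by have := no y; rewrite !inE vE eq_sym xy eqxx orbT.
      + rewrite !inE vE => /andP[zx /orP[/eqP ->|/eqP zx']] //=; last by rewrite zx' eqxx in zx.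
        by rewrite setUC adj_sym.
      + by have := no x; rewrite !inE vE xy eqxx.
    rewrite -(card_in_imset (f := other)).
      apply/subset_leq_card/subsetP => _ /imsetP[e + ->].
      by rewrite /supp !inE orbF => /otherP[].
    move=> e e'; rewrite /supp !inE !orbF => /otherP[eE _] /otherP[eE' _] ee.
    by apply: val_inj; rewrite eE eE' ee.
  - apply: (@leq_trans (0 + 4)); last by lia.
    apply: leq_add.
      by rewrite leqn0 cards_eq0; apply/eqP/setP => q; rewrite /supp !inE.
    by apply: leq_trans (p4 j); apply/subset_leq_card/subsetP => e; rewrite /supp !inE.
  - apply: (@leq_trans (w + A)); last by lia.
    apply: leq_add.
      by apply: leq_trans (sw i); apply/subset_leq_card/subsetP => q; rewrite /supp !inE.
    by apply: leq_trans (muA i); apply/subset_leq_card/subsetP => e; rewrite /supp !inE.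
move=> x; rewrite [[set _ | _]]sum_set_parts card_sum_set.
rewrite [lpart _]sum_set_parts card_sum_set.
case: x => [q|e].
- apply: (@leq_trans (1 + 0 + D)); last by lia.
  apply: leq_add; first apply: leq_add.
  + apply: leq_trans (qubit_vertex_check_le sgn q).
    by apply/subset_leq_card/subsetP => v; rewrite !inE.
  + by rewrite leqn0 cards_eq0; apply/eqP/setP => j; rewrite /supp !inE.
  + by apply: leq_trans (sD q); apply/subset_leq_card/subsetP => i; rewrite /supp !inE.
- apply: (@leq_trans (2 + B + D * 2)); last by lia.
  apply: leq_add; first apply: leq_add.
  + rewrite -(edges_card (valP e)); apply/subset_leq_card/subsetP => v.
    by rewrite /supp !inE orbF.
  + by apply: leq_trans (pB e); apply/subset_leq_card/subsetP => j; rewrite /supp !inE.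
  + by apply: leq_trans (muD e); apply/subset_leq_card/subsetP => i; rewrite /supp !inE.
Qed.

End DeformedLdpc.

(** * Suitable graphs for a logical of X type *)

Section Suitable.
Variables (Q I : finType) (S : {set Q}) (s : I -> pauli Q) (w D : nat) (k : 'Z_4).
Hypothesis s_code : stabilizer_code s.
Hypothesis s_ldpc : ldpc s w D.
Hypothesis L_logical : Pauli k S set0 \in logicals s.

Lemma logical_even i : ~~ odd #|zpart (s i) :&: S|.
Proof.
have /commuteE := logicalsP _ _ L_logical i.
by rewrite /= set0I cards0 => ->.
Qed.

(** A single vertex suffices here: an even subset of at most one qubit is empty, so every edge set
    can be empty. *)
Lemma isolated_suitable w' D' : #|S| <= 1 -> w <= w' -> 0 < w' -> D < D' ->
  exists G : aux_graph S, suitable G w' D' s /\ #|edge G| = 0.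
Proof.
move=> S1 ww w1 D1.
(* The [1 - #|S|] dummies supply the vertex when [S] is empty. *)
have e0 : forall E : {set {q | q \in S} + 'I_(1 - #|S|)}, E \in set0 -> #|E| = 2.
  by move=> E; rewrite inE.
pose G := AuxGraph e0.
have no_edge (e : edge G) : False by have := valP e; rewrite inE.
have edge0 (c : {set edge G}) : c = set0 by apply/setP => e; case: (no_edge e).
have cardV : #|vertex G| = 1.
  by rewrite card_sum card_ord card_sig (eq_card (B := S)) // subnKC.
exists G; split; last first.
  by apply/eqP; rewrite -leqn0 leqNgt; apply/negP => /card_gt0P[e]; case: (no_edge e).
have conn : connected_graph G.
  split; first by rewrite cardV.
  move=> u v; have /card_le1P : #|vertex G| <= 1 by rewrite cardV.
  by move=> /(_ u isT v); rewrite !inE => /esym/eqP ->; exact: connect0.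
pose p (j : 'I_0) : {set edge G} := set0.
pose mu (i : I) : {set edge G} := set0.
have p_cyc j : boundary (p j) = set0 by rewrite /p boundary0.
have p_gen : generates_cycle_space p.
  by move=> c _; exists set0; rewrite (edge0 [set _ | _]) (edge0 c).
have mu_b i : boundary (mu i) = vertices_in G (zpart (s i)).
  rewrite /mu boundary0; apply/esym/eqP; rewrite -cards_eq0.
  have := card_qubits_inI [set: vertex G] (zpart (s i)).
  rewrite qubits_in_setT setTI => <-.
  have := logical_even i; rewrite setIC.
  have : #|S :&: zpart (s i)| <= 1 by rewrite (leq_trans _ S1) // subset_leq_card ?subsetIl.
  by case: (#|_|) => [|[|]].
split=> //; exists 'I_0, p, mu; split=> //.
- by split=> // -[].
- exact: deformed_stabilizer_code.
- move=> sgn; split.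
    case=> [[v|[]]|i] //; rewrite /weight [supp _]sum_set_parts card_sum_set.
      rewrite (edge0 (rpart _)) cards0 addn0 (leq_trans _ w1) //.
      rewrite leqNgt; apply/negP => /card_gt1P[q [q' [+ + /eqP[]]]].
      by rewrite /supp !inE !orbF; case: v => // u /eqP -> /eqP ->.
    rewrite (edge0 (rpart _)) cards0 addn0 (leq_trans _ ww) //.
    have [sw _] := s_ldpc; apply: leq_trans (sw i).
    by apply/subset_leq_card/subsetP => q; rewrite /supp !inE.
  case=> [q|e]; last by case: (no_edge e).
  rewrite [[set _ | _]]sum_set_parts card_sum_set [lpart _]sum_set_parts card_sum_set.
  rewrite (leq_trans _ D1) //; apply: (@leq_trans (1 + 0 + D)); last by lia.
  apply: leq_add; first apply: leq_add.
  + apply: leq_trans (qubit_vertex_check_le sgn q).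
    by apply/subset_leq_card/subsetP => v; rewrite !inE.
  + by rewrite leqn0 cards_eq0; apply/eqP/setP => -[].
  + have [_ sD] := s_ldpc; apply: leq_trans (sD q).
    by apply/subset_leq_card/subsetP => i; rewrite /supp !inE.
- move=> sgn; apply: deformed_distance => // K.
  rewrite (edge0 (coboundary K)) cards0 leqn0.
  have : #|qubits_in K| + #|S :\: qubits_in K| <= 1.
    apply: leq_trans S1; rewrite -(cardsID (qubits_in K) S) leq_add2r subset_leq_card //.
    by apply/subsetP => q; rewrite !inE; case: insubP => // u -> _ ->.
  by lia.
Qed.

(** A qubit meets at most [D] checks, each containing at most [w] qubits. *)
Definition cover_degree := D * w.
Definition colours := ('I_(cover_degree + cover_degree * cover_degree).+1 *
  'I_(cover_degree + cover_degree * cover_degree).+1)%type.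
Definition network_degree := #|{: 'I_5 + colours * bool}| * 2.

Lemma network_suitable m : #|S| <= 2 ^ m.+1 ->
  exists G : aux_graph S,
    suitable G (network_degree + w + 3 * w + 5)
      (D * 2 + (network_degree.+1 ^ 4) ^ 4 + 3) s /\
    #|edge G| <= (#|S| + 2 ^ m.+1 * m.+1 * m.+1) * network_degree.
Proof.
move=> Sm; have [sw sD] := s_ldpc.
have [iota iota_inj] : exists iota : {q | q \in S} -> {set 'I_m.+1}, injective iota.
  have cardS : #|{: {q | q \in S}}| <= #|{: {set 'I_m.+1}}|.
    by rewrite card_sig (eq_card (B := S)) // -cardsT -powersetT card_powerset cardsT card_ord.
  exists (fun u => enum_val (widen_ord cardS (enum_rank u))) => u v.
  by move=> /enum_val_inj /(congr1 val) /= /val_inj /enum_rank_inj.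
pose meet (u v : {q | q \in S}) := [exists i, (val u \in zpart (s i)) && (val v \in zpart (s i))].
(* The conflict graph is transported to hypercube vertices, where its involutions can be routed. *)
pose r x y := (x != y) && [exists u, exists v, [&& iota u == x, iota v == y & meet u v]].
have r_sym : symmetric r.
  suff H x y : r x y -> r y x by move=> x y; apply/idP/idP; exact: H.
  move=> /andP[xy /existsP[u /existsP[v /and3P[ux vy /existsP[i /andP[ui vi]]]]]].
  rewrite /r eq_sym xy; apply/existsP; exists v; apply/existsP; exists u.
  by rewrite ux vy; apply/existsP; exists i; rewrite ui vi.
have r_irr : irreflexive r by move=> x; rewrite /r eqxx.
have r_deg x : #|[set y | r x y]| <= cover_degree.
  have [->|[y]] := set_0Vmem [set y | r x y]; first by rewrite cards0.
  rewrite inE => /andP[_ /existsP[u /existsP[_ /and3P[/eqP ux _ _]]]].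
  apply: leq_trans (_ : #|\bigcup_(i in [set i | val u \in supp (s i)])
     (iota @: [set v | val v \in zpart (s i)])| <= _).
    apply/subset_leq_card/subsetP => z; rewrite inE.
    move=> /andP[_ /existsP[u' /existsP[v /and3P[/eqP u'x /eqP vz /existsP[i /andP[ui vi]]]]]].
    have {u' u'x ui} ui : val u \in zpart (s i) by rewrite (iota_inj u u') // ux u'x.
    apply/bigcupP; exists i; first by rewrite inE /supp inE ui orbT.
    by rewrite -vz; apply: imset_f; rewrite inE.
  apply: leq_trans (leq_card_bigcup (n := w) _) _; last by rewrite leq_mul2r sD orbT.
  move=> i _; rewrite card_imset // (leq_trans _ (sw i)) //.
  rewrite -(card_imset _ (val_inj : injective (val : {q | q \in S} -> Q))).
  apply/subset_leq_card/subsetP => _ /imsetP[v vi ->].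
  by rewrite inE in vi; rewrite /supp inE vi orbT.
have [f [fK fr]] := involution_cover r_sym r_irr r_deg.
have [P PP] := fin_all_exists (fun c => benes (inv_inj (fK c))).
pose G := network iota P.
have P_inj c j : injective (P c j) by have [] := PP c.
have P0 c : P c 0 =1 f c by have [] := PP c.
have Pend c : P c m.+1 =1 id by have [] := PP c.
have Pstep c (a : 'I_m.+1) x : exists y z, [/\ y = x \/ y = flip a x,
      z = P c a.+1 y & P c a x = z \/ P c a x = flip a z].
  by have [_ _ _ ps] := PP c; exact: ps.
have h_inj := network_step_inj iota_inj P_inj.
have deg (u : vertex G) : #|[set v | adj u v]| <= network_degree.
  exact: (function_graph_degree h_inj).
(* The level 0 residual is the involution itself, so its rung is a shortcut between the two
   nodes. *)
have meet_near u v : meet u v ->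
    near (at_node iota P (iota u) ord0 ord0) (at_node iota P (iota v) ord0 ord0).
  move=> uv; have [->|ne] := eqVneq (iota u) (iota v); first by left.
  have [c fc] : exists c, f c (iota u) = iota v.
    apply: fr; rewrite /r ne; apply/existsP; exists u; apply/existsP; exists v.
    by rewrite !eqxx.
  by rewrite -fc -P0; exact: (near_rung iota P c false).
pose Z i := [set u : {q | q \in S} | val u \in zpart (s i)].
pose mu i : {set edge G} := local_matching iota P (enum (Z i)).
have cardZ i : #|Z i| = #|zpart (s i) :&: S|.
  rewrite -(card_imset _ (val_inj : injective (val : {q | q \in S} -> Q))).
  apply: eq_card => q; rewrite inE; apply/imsetP/andP => [[u uZ ->]|[qz qS]].
    by rewrite inE in uZ; rewrite uZ (valP u).
  by exists (Sub q qS); rewrite ?inE.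
have mu_b i : boundary (mu i) = vertices_in G (zpart (s i)).
  rewrite (local_matching_boundary (conn := meet)) ?enum_uniq //.
  - apply/setP => -[u|n]; rewrite !inE.
      rewrite (mem_imset (f := qubit_vertex iota P)) ?mem_enum ?inE //; first by move=> ? ? [].
    by apply/negbTE/imsetP => -[].
  - by rewrite -cardE cardZ logical_even.
  - move=> u v; rewrite !mem_enum !inE => ui vi.
    by apply/existsP; exists i; rewrite ui vi.
exists G; split; last first.
  apply: leq_trans (card_function_graph _) _.
  rewrite card_sum card_sig (eq_card (B := S)) // !card_prod card_ord.
  rewrite -(cardsT {set 'I_m.+1}) -powersetT card_powerset cardsT card_ord.
  by rewrite leq_mul2l leq_pmulr ?orbT.
have conn : connected_graph G by exact: network_connected.
split=> //; exists {t | @short_cycle Q S G t}, (@short_cycle_edges Q S G), mu.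
have gen : generates_cycle_space (@short_cycle_edges Q S G).
  exact: (network_generates Pend Pstep).
split=> //.
- by split=> //; exact: short_cycle_is_cycle.
- exact: (deformed_stabilizer_code conn (@short_cycle_boundary Q S G)).
- move=> sgn; apply: (deformed_ldpc _ s_ldpc deg).
  + exact: card_short_cycle.
  + exact: short_cycle_congestion.
  + move=> i; apply: leq_trans (card_local_matching _ _ _) _.
    rewrite leq_mul2l -cardE cardZ /= (leq_trans _ (sw i)) // subset_leq_card //.
    by rewrite /supp subIset // subsetUr.
  (* At most two qubits have their grid node at an end of [e], and each lies in at most [D]
     checks. *)
  + move=> e; pose U := [set u | at_node iota P (iota u) ord0 ord0 \in val e].
    apply: leq_trans (_ : #|\bigcup_(u in U) [set i | val u \in supp (s i)]| <= _).
      apply/subset_leq_card/subsetP => i; rewrite inE => /local_matching_sub[u].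
      rewrite mem_enum inE => ui ue; apply/bigcupP; exists u; first by rewrite inE.
      by rewrite inE /supp inE ui orbT.
    apply: leq_trans (leq_card_bigcup (n := D) _) _; first by move=> u _; exact: sD.
    rewrite mulnC leq_mul2l; apply/orP; right.
    rewrite -(edges_card (valP e)).
    have at_inj : injective (fun u => at_node iota P (iota u) ord0 ord0) by move=> u v [/iota_inj].
    rewrite -(card_imset _ at_inj); apply/subset_leq_card/subsetP => _ /imsetP[u uU ->].
    by rewrite inE in uU.
- move=> sgn; apply: (deformed_distance conn gen mu_b) => K.
  exact: network_expansion.
Qed.

End Suitable.

(* The asymptotic bound and the theorem *)
From mathcomp Require Import all_classical all_reals all_analysis.

(** As [m.+1 <= 2 * m], the grids contribute at most 8 W m^2 and the leaves W; both are relaxed to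
    multiples of W m^3, whence 9, and m is at most ln W / ln 2. *)
Lemma log_bound (R : realType) (W m : nat) : (0 < m)%N -> (2 ^ m <= W)%N ->
  (((W + 2 ^ m.+1 * m.+1 * m.+1)%:R : R) <= 9 / ln 2 ^+ 3 * (W%:R * ln W%:R ^+ 3))%R.
Proof.
move=> m0 mW; have ln2 : (0 < ln 2 :> R)%R by rewrite ln_gt0 // ltr1n.
have W0 : (0 < W)%N by apply: leq_trans mW; rewrite expn_gt0.
have mln : (m%:R * ln 2 <= ln W%:R :> R)%R.
  by rewrite mulr_natl -lnXn // -natrX ler_ln ?posrE ?ltr0n ?expn_gt0 // ler_nat.
have -> : (9 / ln 2 ^+ 3 * (W%:R * ln W%:R ^+ 3) = 9 * W%:R * (ln W%:R / ln 2) ^+ 3 :> R)%R.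
  by field; rewrite gt_eqF.
have mle : (m%:R <= ln W%:R / ln 2 :> R)%R by rewrite ler_pdivlMr.
apply: (@le_trans _ _ (9 * W%:R * m%:R ^+ 3 : R)%R); last first.
  by rewrite ler_wpM2l ?mulr_ge0 // lerXn2r ?nnegrE // (le_trans _ mle).
rewrite -natrX -!natrM ler_nat expnS.
have : (m * m >= 1)%N by rewrite muln_gt0 m0.
have : (m.+1 <= 2 * m)%N by lia.
move: mW; set p := (2 ^ m)%N; move=> mW m2 mm.
have h1 : (2 * p * m.+1 * m.+1 <= 2 * W * (2 * m) * (2 * m))%N.
  by rewrite !leq_mul.
have h2 : (2 * W * (2 * m) * (2 * m) = 8 * W * (m * m))%N by lia.
have h3 : (8 * W * (m * m) <= 8 * W * m ^ 3)%N.
  by rewrite leq_mul2l !expnS expn0 muln1 leq_pmull ?orbT.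
have h4 : (W <= W * m ^ 3)%N by rewrite leq_pmulr // expn_gt0 m0.
rewrite (_ : 9 * W * m ^ 3 = W * m ^ 3 + 8 * W * m ^ 3)%N; last by lia.
by rewrite leq_add // (leq_trans h1) // h2.
Qed.

Theorem theorem3 (R : realType) (T : Type) (Q I : T -> finType)
    (s : forall t : T, I t -> pauli (Q t))
    (s_code : forall t : T, stabilizer_code (s t))
    (s_qldpc : qldpc s) :
  exists (c : R) (w D : nat),
  forall (t : T) (L : pauli (Q t)), L \in logicals (s t) ->
  exists phi : pauli (Q t) -> pauli (Q t),
    [/\ basis_change phi,
        exists k : 'Z_4, phi L = Pauli k (supp L) finset.set0
      & exists G : aux_graph (supp L),
          suitable G w D (fun i : I t => phi (s t i)) /\
          (#|edge G|%:R <= c * ((weight L)%:R * ln (weight L)%:R ^+ 3))%R].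
Proof.
have [w [D s_ldpc]] := s_qldpc.
pose N := network_degree w D.
(* All three constants depend only on [w] and [D], hence are uniform over the family. *)
exists (N%:R * (9 / ln 2 ^+ 3))%R, (N + w + 3 * w + 5)%N, (D * 2 + (N.+1 ^ 4) ^ 4 + 3)%N.
move=> t L Llog; have [phi [phi_bc [k phiL]]] := basis_change_to_X L.
exists phi; split=> //; first by exists k.
have phi_code := basis_change_stabilizer phi_bc (s_code t).
have phi_log : Pauli k (supp L) finset.set0 \in logicals (phi \o s t).
  by rewrite -phiL; exact: basis_change_logical.
have phi_ldpc : ldpc (phi \o s t) w D.
  have [_ _ phi_supp] := phi_bc; have [sw sD] := s_ldpc t; split=> [i|q] /=.
    by rewrite /weight phi_supp; exact: sw.
  by under eq_finset do rewrite phi_supp; exact: sD.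
(* For weight at most 1 the bound is 0, so the graph must have no edges. *)
case: (leqP (weight L) 1) => [L1|L2].
  have [|||G [Gs Ge]] := isolated_suitable
    (w' := N + w + 3 * w + 5) (D' := D * 2 + (N.+1 ^ 4) ^ 4 + 3)
    phi_code phi_ldpc phi_log L1; try lia.
  exists G; split=> //; rewrite Ge; case: (weight L) L1 => [|[|//]] _.
    by rewrite !mul0r mulr0.
  by rewrite ln1 expr0n /= !mulr0.
have W0 : (0 < weight L)%N by lia.
(* The hypercube of dimension [m.+1] has room for the support and at most twice as many vertices as
   the weight; weight at least 2 gives [m > 0]. *)
pose m := trunc_log 2 (weight L).
have /andP[mW Wm] := trunc_log_bounds (isT : (1 < 2)%N) W0.
have m0 : (0 < m)%N by rewrite trunc_log_gt0.
have [G [Gs Ge]] := network_suitable phi_code phi_ldpc phi_log (ltnW Wm).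
exists G; split=> //; rewrite -mulrA.
apply: (le_trans (y := (N%:R * (weight L + 2 ^ m.+1 * m.+1 * m.+1)%:R)%R)).
  by rewrite -natrM ler_nat mulnC.
by rewrite ler_wpM2l // log_bound.
Qed.
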